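(* Let $G$ be a finite group, $F$ an algebraically closed field of characteristic zero and $\tau$ an involution of $G$. Let $\mathcal{V}=\operatorname{var}^\sharp(A)$ be a $(G,* )$-variety generated by a finite-dimensional $(G,* )$-algebra $A$ over $F$, where $*$ is a $\tau$-involution on $A$. Then the sequence $c_n^\sharp(A)$, $n\ge1$, is either polynomially bounded or grows exponentially.
   Context: $G$ is a finite group (not necessarily abelian) with identity $1$, and $\tau:G\to G$ is a fixed involution of $G$: $\tau(gh)=\tau(h)\tau(g)$ and $\tau(\tau(g))=g$. Algebras are associative over $F$. A $G$-graded algebra is $A=\bigoplus_{g\in G}A_g$ with $A_gA_h\subseteq A_{gh}$. An involution on $A$ is an $F$-linear map $*$ with $(ab)^*=b^*a^*$, $(a^* )^*=a$. It is a $\tau$-involution if $(A_g)^*\subseteq A_{\tau(g)}$ for all $g$. A $(G,* )$-algebra is a $G$-graded algebra with a $\tau$-involution. Let $\mathcal{F}$ be the free associative algebra on variables $x_{k,g},x_{k,g}^*$ ($k\in\mathbb{N}$, $g\in G$), graded by $\deg x_{k,g}=g$, $\deg x_{k,g}^*=\tau(g)$ (extended multiplicatively to monomials), with the involution exchanging $x_{k,g}$ and $x_{k,g}^*$. $f\in\mathcal{F}$ is a $(G,* )$-identity of $A$ if it vanishes whenever each $x_{k,g}$ is replaced by an element $a\in A_g$ and $x_{k,g}^*$ by $a^*$. $\operatorname{Id}^\sharp(A)$ is the set of all $(G,* )$-identities of $A$, and $\operatorname{var}^\sharp(A)$ is the class of all $(G,* )$-algebras $B$ with $\operatorname{Id}^\sharp(A)\subseteq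 \operatorname{Id}^\sharp(B)$. Let $P_n^\sharp$ be the span of all monomials $x_{\sigma(1),g_1}^{\epsilon_1}\cdots x_{\sigma(n),g_n}^{\epsilon_n}$ with $\sigma\in S_n$, $g_i\in G$, $\epsilon_i\in\{\emptyset,*\}$, and put $c_n^\sharp(A)=\dim_F P_n^\sharp/(P_n^\sharp\cap\operatorname{Id}^\sharp(A))$. Polynomially bounded means $c_n^\sharp(A)\le \alpha n^t$ for all $n\ge1$, for some constants $\alpha,t\ge0$. Growing exponentially means there are constants $\alpha,\gamma>0$ and $\beta,\delta>1$ with $\alpha\beta^n\le c_n^\sharp(A)\le\gamma\delta^n$ for all $n\ge1$. *)

(* Defs.v *)
From HB Require Import structures.
From mathcomp Require Import all_boot all_order all_fingroup all_algebra.
From mathcomp Require Import boolp classical_sets reals exp.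
From mathcomp Require Import finmap monalg.

Set Implicit Arguments.
Unset Strict Implicit.
Unset Printing Implicit Defensive.

Import Order.TTheory GRing.Theory Num.Theory.

Local Open Scope ring_scope.

(* A G-graded algebra structure with tau-involution on the vector space A, with G the whole of gT.
   Algebras need not have a unit, hence the product is part of the record
   instead of coming from lalgType. *)
Record gstar_algebra (F : fieldType) (gT : finGroupType) (tau : gT -> gT)
    (A : lmodType F) := GStarAlgebra {
  gmul : A -> A -> A;
  gmulA : associative gmul;
  gmulDl : left_distributive gmul +%R;
  gmulDr : right_distributive gmul +%R;
  gscaleAl : forall (c : F) (a b : A), c *: gmul a b = gmul (c *: a) b;
  gscaleAr : forall (c : F) (a b : A), c *: gmul a b = gmul a (c *: b);
  gcomp : gT -> {pred A};
  gcomp_submod : forall g, submod_closed (gcomp g);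
  gcomp_sum : forall a : A, exists2 u : gT -> A,
    forall g, u g \in gcomp g & a = \sum_(g : gT) u g;
  gcomp_direct : forall u : gT -> A,
    (forall g, u g \in gcomp g) -> \sum_(g : gT) u g = 0 -> forall g, u g = 0;
  gcomp_mul : forall g h a b,
    a \in gcomp g -> b \in gcomp h -> gmul a b \in gcomp (g * h)%g;
  gstar : A -> A;
  gstarD : forall a b, gstar (a + b) = gstar a + gstar b;
  gstarZ : forall (c : F) a, gstar (c *: a) = c *: gstar a;
  gstarM : forall a b, gstar (gmul a b) = gmul (gstar b) (gstar a);
  gstarK : involutive gstar;
  gstar_comp : forall g a, a \in gcomp g -> gstar a \in gcomp (tau g)
}.

(* (k, g, false) is x_{k,g} and (k, g, true) is x_{k,g}^*. *)
Definition gvar (gT : finGroupType) : choiceType := (nat * gT * bool)%type.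

(* The unital free algebra on the variables. Since algebras need not have a
   unit, the polynomials that can be evaluated are those without constant term,
   which form the free associative algebra of the theory; gstar_id imposes this
   condition. *)
Definition gfree (F : fieldType) (gT : finGroupType) :=
  {malg F[{fmonom gvar gT}]}.

Section Identities.
Context (F : fieldType) (gT : finGroupType) (tau : gT -> gT).
Context (A : lmodType F) (S : gstar_algebra tau A).

Definition gsubst_var (a : nat -> gT -> A) (v : gvar gT) : A :=
  let: (k, g, e) := v in if e then gstar S (a k g) else a k g.

(* The empty word gets the junk value 0. *)
Definition gprod (s : seq A) : A :=
  if s is b :: s' then foldl (gmul S) b s' else 0.

Definition gsubst (a : nat -> gT -> A) (f : gfree F gT) : A :=
  \sum_(m <- msupp f) f@_m *: gprod [seq gsubst_var a v | v <- fmonom_val m].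

Definition gstar_id (f : gfree F gT) : Prop :=
  f@_(@fmone (gvar gT)) = 0 /\
  forall a : nat -> gT -> A,
    (forall k g, a k g \in gcomp S g) -> gsubst a f = 0.

End Identities.

Definition gstar_class (F : fieldType) (gT : finGroupType) (tau : gT -> gT) :=
  forall B : lmodType F, gstar_algebra tau B -> Prop.

Definition gstar_var (F : fieldType) (gT : finGroupType) (tau : gT -> gT)
    (A : lmodType F) (S : gstar_algebra tau A) : gstar_class F tau :=
  fun B T => forall f : gfree F gT, gstar_id S f -> gstar_id T f.

(* The indices of the variables are 0, ..., n-1. *)
Definition gmonomial (F : fieldType) (gT : finGroupType) (n : nat)
    (s : 'S_n) (g : {ffun 'I_n -> gT}) (e : {ffun 'I_n -> bool}) :
    gfree F gT :=
  \prod_(i < n) << fmu ((s i : nat), g i, e i) >>.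

Definition gmultilinear (F : fieldType) (gT : finGroupType) (n : nat)
    (f : gfree F gT) : Prop :=
  exists c : 'S_n -> {ffun 'I_n -> gT} -> {ffun 'I_n -> bool} -> F,
    f = \sum_s \sum_g \sum_e c s g e *: gmonomial F s g e.

(* The quotient W / (W \cap I) of subspaces of V has a basis with d elements. *)
Definition quot_dim (F : fieldType) (V : lmodType F) (W I : V -> Prop)
    (d : nat) : Prop :=
  exists e : 'I_d -> V,
    [/\ forall i, W (e i),
        forall w, W w -> exists c : 'I_d -> F, I (w - \sum_i c i *: e i)
      & forall c : 'I_d -> F, I (\sum_i c i *: e i) -> forall i, c i = 0].

(* The default 0 of xget is never used: the quotient is spanned by the finitely
   many monomials, so its dimension exists. *)
Definition gcodim (F : fieldType) (gT : finGroupType) (tau : gT -> gT)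
    (A : lmodType F) (S : gstar_algebra tau A) (n : nat) : nat :=
  xget 0%N [set d | quot_dim (@gmultilinear F gT n) (gstar_id S) d]%classic.

Definition poly_bounded (R : realType) (c : nat -> nat) : Prop :=
  exists alpha t : R, [/\ 0 <= alpha, 0 <= t
    & forall n, (1 <= n)%N -> (c n)%:R <= alpha * n%:R `^ t].

Definition exp_growth (R : realType) (c : nat -> nat) : Prop :=
  exists alpha beta gamma delta : R,
    [/\ 0 < alpha, 0 < gamma, 1 < beta, 1 < delta
      & forall n, (1 <= n)%N ->
          alpha * beta ^+ n <= (c n)%:R /\ (c n)%:R <= gamma * delta ^+ n].

(* Main.v *)
From HB Require Import structures.
Require Import Defs.
From mathcomp Require Import all_boot all_order all_fingroup all_algebra.
From mathcomp Require Import boolp classical_sets reals exp.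
From mathcomp Require Import finmap monalg.
From mathcomp Require Import ring zify.

Set Implicit Arguments.
Unset Strict Implicit.
Unset Printing Implicit Defensive.

Import Order.TTheory GRing.Theory Num.Theory.
Import VectorInternalTheory.

Local Open Scope ring_scope.

(** Let c_n denote the codimensions of A.  The upper bound c_n <= N^n dim A
    always holds: a multilinear polynomial is an identity as soon as it
    vanishes on the n-tuples taken from a fixed finite homogeneous spanning
    family.  So the claim is a dichotomy for the lower bound: either
    2^(n-1) <= c_n for all n >= 1, or c_n is bounded by a polynomial.

    Three kinds of elements force 2^(n-1) <= c_n, because they provide
    evaluations that tell 2^(n-1) monomials apart:
    - a homogeneous non-nilpotent element of degree g <> 1: each of the n
      variables may be given degree g or degree 1
      ([exponential_of_degree]);
    - idempotents e, f of degree 1 with fe = 0 and eAf <> 0: each variable may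
      stand to the left or to the right of a marked one
      ([exponential_of_bimodule]);
    - a non-nilpotent b of degree 1 commuting with its star b', with bb'
      nilpotent: each variable may be starred or not ([exponential_of_star]).

    Suppose that there are no such elements.  Take a maximal family e_1,...,e_m
    of nonzero orthogonal symmetric idempotents of degree 1.  Then
    e_i A e_j = 0 for i <> j.  Maximality makes a symmetric element of degree 1
    nilpotent outside the e_i, and a scalar plus a nilpotent inside
    e_i A e_i.  Let t(x) = tr(x) + tr(x'), where tr is the trace in the regular
    representation and x' is the star of x.  In characteristic zero t vanishes
    on nilpotent elements and not on nonzero idempotents, so the radical
    K = { x | t(xy) = 0 for all y } is a nil ideal; it is stable under the star.
    Working in the Peirce corners, one computes
    t(xy) = t(x) t(y) / t(e_i) on e_i A e_i ([corner_form]) and deduces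
    that every homogeneous component of A lies in the span of the e_i of the
    same degree plus its intersection with K ([gcomp_frame_radical]).  Thus A
    is the sum of a product of copies of F and a nil ideal.

    Since K is nilpotent ([gprod_nil_ideal]), a product of many elements, each
    one of the e_i or in K, vanishes if two different e_i occur or if more
    than dim A factors lie in K.  Hence the only n-tuples of the spanning family
    that matter are constant up to at most dim A entries.  Their number is
    polynomial in n ([card_almost_constant]), and so is c_n
    ([gcodim_le], [poly_upper_bound]). *)

(** * Traces and idempotents of matrices *)

(** A nilpotent M is singular, so M = CR with inner dimension the rank r < n;
    then RC is a nilpotent matrix of size r with the same trace. *)
Lemma mxtrace_nilpotent (F : fieldType) n (M : 'M[F]_n) k :
  iter k (mulmx M) 1%:M = 0 -> \tr M = 0.
Proof.
elim/ltn_ind: n M k => -[|n] IHn M k Mk0; first by rewrite flatmx0 linear0.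
have [rkM|rkM] := ltnP (\rank M) n.+1.
  pose C := col_base M; pose R := row_base M.
  have defM : C *m R = M by apply: mulmx_base.
  rewrite -defM mxtrace_mulC; apply: (IHn _ rkM _ k.+1).
  have shift j : iter j.+1 (mulmx (R *m C)) 1%:M = R *m iter j (mulmx M) 1%:M *m C.
    elim: j => [|j IHj]; first by rewrite /= !mulmx1.
    rewrite iterS IHj iterS; set X := iter j _ _.
    have -> : M *m X = C *m R *m X by rewrite defM.
    by rewrite !mulmxA.
  by rewrite shift Mk0 mulmx0 mul0mx.
have uM : M \in unitmx by rewrite -row_free_unit -row_leq_rank.
have : iter k (mulmx M) 1%:M \in unitmx.
  by elim: k {Mk0} => [|k IHk]; rewrite /= ?unitmx1 // unitmx_mul uM.
by rewrite Mk0 -row_free_unit /row_free mxrank0.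
Qed.

(** In the rank factorization M = CR, idempotence amounts to RC = 1. *)
Lemma mxtrace_idempotent (F : fieldType) n (M : 'M[F]_n) :
  M *m M = M -> \tr M = (\rank M)%:R.
Proof.
move=> MM; pose C := col_base M; pose R := row_base M.
have defM : C *m R = M by apply: mulmx_base.
suff RC1 : R *m C = 1%:M by rewrite -{1}defM mxtrace_mulC RC1 mxtrace1.
have [C' C'C] : exists C', C' *m C = 1%:M by apply/row_fullP; exact: col_base_full.
have [R' RR'] : exists R', R *m R' = 1%:M by apply/row_freeP; exact: row_base_free.
clearbody C R; move: (\rank M) C R defM C' C'C R' RR' => r C R defM C' C'C R' RR'.
have -> : R *m C = C' *m (C *m R *m (C *m R)) *m R'.
  by rewrite !mulmxA C'C mul1mx -!mulmxA RR' mulmx1.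
by rewrite defM MM -defM !mulmxA C'C mul1mx RR'.
Qed.

(** The projection on the part where M is invertible.  Write the characteristic
    polynomial as 'X^k nu with nu(0) <> 0; a Bezout relation between 'X^(k+1)
    and nu produces the idempotent.  The exponent k + 1, rather than k, ensures
    that this polynomial in M has no constant term, so that the idempotent
    stays in any non-unital algebra containing M. *)
Lemma fitting_idempotent (F : fieldType) n (M : 'M[F]_n.+1) :
    (forall k, M ^+ k != 0) ->
  exists q : {poly F}, let E := horner_mx M ('X * q) in E * E = E /\ E != 0.
Proof.
move=> nilM; pose chi := char_poly M.
have chi0 : horner_mx M chi = 0 by apply: Cayley_Hamilton.
have [k [nu nu0 def_chi]] := multiplicity_XsubC chi 0.
have {nu0}nu0 : ~~ root nu 0.
  by apply: (implyP nu0); rewrite monic_neq0 // char_poly_monic.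
rewrite subr0 in def_chi.
have cop : coprimep ('X^(k.+1)) nu.
  by rewrite coprimep_expl // coprimep_sym -[X in coprimep _ X]subr0 coprimep_XsubC.
have [[u v] /=] := Bezout_coprimepP _ _ cop.
rewrite -size_poly_eq1 => /size_poly1P[c c0 def1].
pose e := (c^-1)%:P * u * 'X^(k.+1); pose f := (c^-1)%:P * v * nu.
have ef1 : e + f = 1.
  by rewrite /e /f -!mulrA -mulrDr def1 -polyCM mulVf.
have ef0 : horner_mx M (e * f) = 0.
  have -> : e * f = ((c^-1)%:P * u * 'X) * ((c^-1)%:P * v) * chi.
    by rewrite /e /f def_chi exprS; ring.
  by rewrite rmorphM /= chi0 mulr0.
exists ((c^-1)%:P * u * 'X^k).
have -> : 'X * ((c^-1)%:P * u * 'X^k) = e.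
  by rewrite /e exprS; ring.
split.
  rewrite -rmorphM /=; have -> : e * e = e - e * f.
    by apply/esym/eqP; rewrite subr_eq -mulrDr ef1 mulr1.
  by rewrite rmorphB /= ef0 subr0.
apply: contra (nilM k) => /eqP e0.
have : horner_mx M ('X^k * (e + f)) = 0.
  rewrite mulrDr rmorphD /= [in X in X + _]rmorphM /= e0 mulr0 add0r.
  have -> : 'X^k * f = (c^-1)%:P * v * chi by rewrite /f def_chi; ring.
  by rewrite rmorphM /= chi0 mulr0.
by rewrite ef1 mulr1 rmorphXn /= horner_mx_X => ->.
Qed.

(** * The regular representation and the trace form *)

Section GradedStarAlgebra.
Context (F : closedFieldType) (gT : finGroupType) (tau : gT -> gT).
Context (A : vectType F) (S : gstar_algebra tau A).

Local Notation "x ** y" := (gmul S x y) (at level 40, left associativity).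
Local Notation "x ^s" := (gstar S x) (at level 2, format "x ^s").

Lemma gmul_is_linear_l y : linear (fun x => x ** y).
Proof. by move=> c a b; rewrite gmulDl gscaleAl. Qed.
Lemma gmul_is_linear_r x : linear (gmul S x).
Proof. by move=> c a b; rewrite gmulDr gscaleAr. Qed.
Lemma gstar_is_linear : linear (gstar S).
Proof. by move=> c a b; rewrite gstarD gstarZ. Qed.
HB.instance Definition _ x :=
  GRing.isLinear.Build F A A _ (gmul S x) (gmul_is_linear_r x).
HB.instance Definition _ :=
  GRing.isLinear.Build F A A _ (gstar S) gstar_is_linear.

Lemma gmul0r x : 0 ** x = 0.
Proof. by rewrite -[X in X ** x](scale0r (0 : A)) -gscaleAl scale0r. Qed.
Lemma gmulr0 x : x ** 0 = 0. Proof. exact: linear0. Qed.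
Lemma gmulNl x y : (- x) ** y = - (x ** y).
Proof. by rewrite -scaleN1r -gscaleAl scaleN1r. Qed.
Lemma gmulNr x y : x ** (- y) = - (x ** y). Proof. exact: linearN. Qed.
Lemma gmulBl x y z : (x - y) ** z = x ** z - y ** z.
Proof. by rewrite gmulDl gmulNl. Qed.
Lemma gmulBr x y z : x ** (y - z) = x ** y - x ** z. Proof. exact: linearB. Qed.
Lemma gmul_suml (I : Type) (r : seq I) (P : pred I) (E : I -> A) y :
  (\sum_(i <- r | P i) E i) ** y = \sum_(i <- r | P i) E i ** y.
Proof.
by elim/big_rec2: _ => [|i u v _ <-]; rewrite ?gmul0r ?gmulDl.
Qed.
Lemma gmul_sumr (I : Type) (r : seq I) (P : pred I) (E : I -> A) y :
  y ** (\sum_(i <- r | P i) E i) = \sum_(i <- r | P i) y ** E i.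
Proof. exact: linear_sum. Qed.
Lemma gstar0 : 0 ^s = 0. Proof. exact: linear0. Qed.
Lemma gstarB x y : (x - y)^s = x^s - y^s. Proof. exact: linearB. Qed.

Lemma gcomp0 g : 0 \in gcomp S g.
Proof. by case: (gcomp_submod S g). Qed.
Lemma gcompD g x y : x \in gcomp S g -> y \in gcomp S g -> x + y \in gcomp S g.
Proof.
by move=> xg yg; case: (gcomp_submod S g) => _ /(_ 1 x y xg yg); rewrite scale1r.
Qed.
Lemma gcompZ g c x : x \in gcomp S g -> c *: x \in gcomp S g.
Proof.
by move=> xg; case: (gcomp_submod S g) => z0 /(_ c x 0 xg z0); rewrite addr0.
Qed.
Lemma gcompN g x : x \in gcomp S g -> - x \in gcomp S g.
Proof. by rewrite -scaleN1r; apply: gcompZ. Qed.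
Lemma gcompB g x y : x \in gcomp S g -> y \in gcomp S g -> x - y \in gcomp S g.
Proof. by move=> xg /gcompN; apply: gcompD. Qed.

Definition rmulmx (x : A) : 'M[F]_(dim A) := lin1_mx (fun v => v2r (r2v v ** x)).

Lemma rmulmxE x v : v *m rmulmx x = v2r (r2v v ** x).
Proof.
have lin : linear (fun v => v2r (r2v v ** x)).
  by move=> c a b; rewrite !linearP /= gmul_is_linear_l linearP.
pose f := GRing.isLinear.Build _ _ _ _ _ lin.
pose g : {linear 'rV[F]_(dim A) -> 'rV[F]_(dim A)} := HB.pack (fun v => v2r (r2v v ** x)) f.
exact: (mul_rV_lin1 g).
Qed.

(** Right multiplication by x on the unitization F + A, written in row-vector
    convention so that products are not reversed.  The first row records
    1 * x = x and makes the representation faithful. *)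
Definition regmx (x : A) : 'M[F]_((dim A).+1) :=
  block_mx (0 : 'M_1) (v2r x) 0 (rmulmx x) : 'M_(1 + dim A).

Lemma rmulmx_is_linear : linear rmulmx.
Proof.
move=> c a b; apply/row_matrixP => i; rewrite !rowE mulmxDr -scalemxAr !rmulmxE.
by rewrite gmulDr linearD /= -gscaleAr linearZ.
Qed.

Lemma regmx_is_linear : linear regmx.
Proof.
move=> c a b; have -> : c *: regmx a + regmx b =
    c *: (block_mx (0 : 'M_1) (v2r a) 0 (rmulmx a) : 'M_(1 + dim A)) +
    block_mx (0 : 'M_1) (v2r b) 0 (rmulmx b) by [].
rewrite scale_block_mx add_block_mx !scaler0 !addr0 /regmx.
by rewrite rmulmx_is_linear linearP.
Qed.
HB.instance Definition _ := GRing.isLinear.Build F A 'M[F]_((dim A).+1) _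
  regmx regmx_is_linear.

Lemma regmxM x y : regmx (x ** y) = regmx x * regmx y.
Proof.
rewrite /regmx; set B := block_mx _ (v2r x) _ _; set C := block_mx _ (v2r y) _ _.
rewrite -[B * C]/(B *m C) mulmx_block !mul0mx !mulmx0 !addr0 !add0r.
rewrite rmulmxE v2rK; have -> // : rmulmx x *m rmulmx y = rmulmx (x ** y).
by apply/row_matrixP => i; rewrite !rowE mulmxA !rmulmxE v2rK gmulA.
Qed.

Lemma regmx_inj : injective regmx.
Proof. by move=> x y /(@eq_block_mx _ 1 (dim A) 1 (dim A))[_ /v2r_inj]. Qed.

(** Powers are taken in the regular representation, which has a unit. *)
Definition gnil (x : A) := exists k, regmx x ^+ k = 0.

(** The exponents are shifted by one: gpow x n is the power n + 1 of x. *)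
Fixpoint gpow (x : A) n : A := if n is m.+1 then x ** gpow x m else x.

Lemma regmx_pow x n : regmx (gpow x n) = regmx x ^+ n.+1.
Proof. by elim: n => //= n IHn; rewrite regmxM IHn -exprS. Qed.

Lemma not_gnil x : ~ gnil x -> forall k, regmx x ^+ k != 0.
Proof. by move=> nx k; apply/eqP => xk; apply: nx; exists k. Qed.

Lemma gnilM_comm x y : x ** y = y ** x -> gnil x -> gnil (x ** y).
Proof.
move=> xy [k xk]; exists k; rewrite regmxM exprMn_comm ?xk ?mul0r //.
by rewrite /GRing.comm -!regmxM xy.
Qed.

Lemma gnilN x : gnil x -> gnil (- x).
Proof. by case=> k xk; exists k; rewrite linearN exprNn xk mulr0. Qed.

Lemma gstar_pow x k : (gpow x k)^s = gpow (x^s) k.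
Proof.
elim: k => //= k IHk; rewrite gstarM IHk.
by apply: regmx_inj; rewrite !regmxM !regmx_pow -exprSr -exprS.
Qed.

Lemma gnil_star x : gnil x -> gnil (x^s).
Proof.
case=> k xk; exists k.+1; rewrite -regmx_pow -gstar_pow.
suff -> : gpow x k = 0 by rewrite gstar0 linear0.
by apply: regmx_inj; rewrite linear0 regmx_pow exprS xk mulr0.
Qed.

(** The idempotent is a polynomial without constant term in x, hence it
    inherits every linear condition satisfied by all powers of x. *)
Lemma idempotent_of_nonnil x : ~ gnil x ->
  exists n (c : 'I_n -> F), let e := \sum_i c i *: gpow x i in
    e ** e = e /\ e != 0.
Proof.
move=> /not_gnil/fitting_idempotent[q] /=; set E := horner_mx _ _ => -[EE E0].
exists (size q), (fun i => q`_i); set e := \sum_i _.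
have rE : regmx e = E.
  rewrite /E rmorphM /= horner_mx_X.
  transitivity (regmx x * horner_mx (regmx x) (\poly_(i < size q) q`_i));
    last by rewrite coefK.
  rewrite poly_def linear_sum rmorph_sum /=.
  rewrite mulr_sumr; apply: eq_bigr => i _.
  by rewrite linearZ /= regmx_pow linearZ /= rmorphXn /= horner_mx_X -scalerAr exprS.
split; first by apply: regmx_inj; rewrite regmxM rE.
by apply: contraNneq E0 => e0; rewrite -rE e0 linear0.
Qed.

(** Adding the trace of the star of x makes this trace invariant under the
    star, so that skew elements have trace zero. *)
Definition gtr (x : A) : F := \tr (regmx x) + \tr (regmx (x^s)).

Lemma gtr_is_linear : linear_for *%R gtr.
Proof.
by move=> c a b; rewrite /gtr !linearP /= mulrDr addrACA.
Qed.
HB.instance Definition _ := GRing.isLinear.Build F A F _ gtr gtr_is_linear.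

Lemma gtrD x y : gtr (x + y) = gtr x + gtr y. Proof. exact: linearD. Qed.
Lemma gtrB x y : gtr (x - y) = gtr x - gtr y. Proof. exact: linearB. Qed.
Lemma gtrZ c x : gtr (c *: x) = c * gtr x. Proof. exact: linearZ. Qed.

Lemma gtrC x y : gtr (x ** y) = gtr (y ** x).
Proof.
rewrite /gtr !gstarM !regmxM.
by rewrite ![\tr (regmx _ * regmx x)]mxtrace_mulC ![\tr (regmx _ * regmx (x^s))]mxtrace_mulC.
Qed.

Lemma gtr_star x : gtr (x^s) = gtr x.
Proof. by rewrite /gtr gstarK addrC. Qed.

Lemma mxtrace_regmx_nil x : gnil x -> \tr (regmx x) = 0.
Proof.
case=> k xk; apply: (@mxtrace_nilpotent _ _ _ k); rewrite -[RHS]xk.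
by elim: k {xk} => //= k ->; rewrite exprS.
Qed.

Lemma gtr_nil x : gnil x -> gtr x = 0.
Proof.
by move=> nx; rewrite /gtr !mxtrace_regmx_nil ?addr0 //; apply: gnil_star.
Qed.

(** Both summands are ranks, so the sum is a positive integer. *)
Lemma gtr_idem e : [pchar F] =i pred0 -> e ** e = e -> e != 0 -> gtr e != 0.
Proof.
move=> /pcharf0P charF ee e0.
have idem x : x ** x = x -> \tr (regmx x) = (\rank (regmx x))%:R.
  by move=> xx; apply: mxtrace_idempotent; rewrite -[LHS]regmxM xx.
rewrite /gtr !idem -?gstarM ?ee // -natrD charF addn_eq0 mxrank_eq0.
apply: contra e0 => /andP[/eqP e0 _]; apply/eqP/regmx_inj.
by rewrite e0 linear0.
Qed.

End GradedStarAlgebra.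

(** * Dimensions of quotients *)

Definition quot_indep (F : fieldType) (V : lmodType F) (W I : V -> Prop) d :=
  exists e : 'I_d -> V, (forall i, W (e i)) /\
    (forall c : 'I_d -> F, I (\sum_i c i *: e i) -> forall i, c i = 0).

Definition is_submod (F : fieldType) (V : lmodType F) (I : V -> Prop) :=
  I 0 /\ forall c u v, I u -> I v -> I (c *: u + v).

Lemma is_submodI (F : fieldType) (V : lmodType F) (I J : V -> Prop) :
  is_submod I -> is_submod J -> is_submod (fun v => I v /\ J v).
Proof.
move=> [I0 Ilin] [J0 Jlin]; split=> // c u v [uI uJ] [vI vJ].
by split; [apply: Ilin | apply: Jlin].
Qed.

Section QuotDim.
Context (F : fieldType) (V : lmodType F) (W I : V -> Prop).
Context (Isub : is_submod I).

Lemma is_submod_sum (T : Type) (r : seq T) (P : pred T) (c : T -> F) (v : T -> V) :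
  (forall i, P i -> I (v i)) -> I (\sum_(i <- r | P i) c i *: v i).
Proof.
case: Isub => I0 Ilin Iv; elim/big_rec: _ => // i w Pi Iw.
by apply: Ilin => //; apply: Iv.
Qed.

Lemma left_kernel_nontrivial a b (P : 'M[F]_(a, b)) : (b < a)%N ->
  exists2 c : 'rV_a, c != 0 & c *m P = 0.
Proof.
move=> ba; have : kermx P != 0.
  rewrite -mxrank_eq0 mxrank_ker subn_eq0 -ltnNge.
  exact: leq_ltn_trans (rank_leq_col _) ba.
move=> /rowV0Pn[c /sub_kermxP cP c0]; by exists c.
Qed.

(** Steinitz: the coordinates of the independent family modulo I form a
    matrix with more rows than columns. *)
Lemma quot_dim_max d d' : quot_dim W I d -> quot_indep W I d' -> (d' <= d)%N.
Proof.
move=> [e [We spe _]] [u [Wu indu]]; rewrite leqNgt; apply/negP => ltd.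
have [P IP] := boolp.choice (fun i => spe _ (Wu i)).
have [c c0 cP] := left_kernel_nontrivial (\matrix_(i, j) P i j) ltd.
case/negP: c0; apply/eqP/rowP => i; rewrite mxE.
apply: (indu (fun i => c 0 i)).
have -> : \sum_i c 0 i *: u i = \sum_i c 0 i *: (u i - \sum_j P i j *: e j).
  under [RHS]eq_bigr do rewrite scalerBr scaler_sumr.
  rewrite sumrB [X in _ - X]exchange_big /= [X in _ - X]big1 ?subr0 // => j _.
  under eq_bigr do rewrite scalerA.
  rewrite -scaler_suml; have /rowP/(_ j) := cP.
  by rewrite !mxE; under eq_bigr do rewrite mxE; move->; rewrite scale0r.
exact: is_submod_sum.
Qed.

(** An independent family of maximal size spans: a vector outside its span
    could be adjoined. *)
Lemma quot_dim_exists N : (forall d, quot_indep W I d -> (d <= N)%N) ->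
  exists d, quot_dim W I d.
Proof.
move=> bound.
have ex0 : exists d, `[< quot_indep W I d >].
  by exists 0%N; apply/asboolP; exists (fun _ => 0); split=> [[]|c _ []].
have leN d : `[< quot_indep W I d >] -> (d <= N)%N by move/asboolP; apply: bound.
case: (ex_maxnP ex0 leN) => d /asboolP[e [We inde]] dmax.
exists d, e; split=> // w Ww; apply: contrapT => nspan.
have : (d.+1 <= d)%N; last by rewrite ltnn.
apply: dmax; apply/asboolP.
exists (fun i => if unlift ord0 i is Some j then e j else w); split.
  by move=> i; case: unlift.
case: Isub => I0 Ilin c; rewrite big_ord_recl unlift_none.
under eq_bigr do rewrite liftK; move=> Ic.
have [c0|c0] := eqVneq (c ord0) 0.
  move: Ic; rewrite c0 scale0r add0r => /inde cl i.
  by case: (unliftP ord0 i) => [j ->|->].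
case: nspan; exists (fun j => - ((c ord0)^-1 * c (lift ord0 j))).
move: (Ilin (c ord0)^-1 _ _ Ic I0); rewrite addr0 scalerDr scalerA mulVf // scale1r.
rewrite scaler_sumr -sumrN; congr I; congr (_ + _).
by apply: eq_bigr => j _; rewrite scaleNr opprK scalerA.
Qed.

End QuotDim.

(** * Evaluation of polynomials *)

Section Substitution.
Context (F : fieldType) (gT : finGroupType) (tau : gT -> gT).
Context (A : lmodType F) (S : gstar_algebra tau A).

Lemma gsubst_wide (a : nat -> gT -> A) (d : {fset {fmonom gvar gT}}) (f : gfree F gT) :
  (msupp f `<=` d)%fset ->
  gsubst S a f = \sum_(m <- d) f@_m *: gprod S [seq gsubst_var S a v | v <- fmonom_val m].
Proof.
move=> le; rewrite [LHS](big_fset_incl _ le) => //= x xd /mcoeff_outdom ->.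
by rewrite scale0r.
Qed.

Lemma gsubst_is_linear a : linear (gsubst S a).
Proof.
move=> c f g; pose d := (msupp f `|` msupp g)%fset.
have fd : (msupp f `<=` d)%fset by apply: fsubsetUl.
have gd : (msupp g `<=` d)%fset by apply: fsubsetUr.
rewrite !(@gsubst_wide a d) //.
  rewrite scaler_sumr -big_split /=; apply: eq_bigr => m _.
  by rewrite mcoeffD mcoeffZ scalerDl scalerA.
by apply: (fsubset_trans (msuppD_le _ _)); apply: fsetSU; apply: msuppZ_le.
Qed.
HB.instance Definition _ a :=
  GRing.isLinear.Build F (gfree F gT) A _ (gsubst S a) (gsubst_is_linear a).

Definition gword (l : seq (gvar gT)) : gfree F gT := << FMonom l >>.

Lemma gsubst_word a l : gsubst S a (gword l) = gprod S (map (gsubst_var S a) l).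
Proof.
rewrite (@gsubst_wide a [fset FMonom l]%fset) ?msuppU_le // big_seq_fset1 mcoeffUU.
by rewrite scale1r.
Qed.

Lemma index_enum_ord n : index_enum 'I_n = enum 'I_n.
Proof. by rewrite [index_enum _]unlock enumT. Qed.

Lemma gmonomialE n (s : 'S_n) g e :
  gmonomial F s g e = gword [seq ((s i : nat), g i, e i) | i <- enum 'I_n].
Proof.
rewrite -index_enum_ord.
rewrite /gmonomial; elim: (index_enum _) => [|i r IHr].
  by rewrite big_nil /gword -fmoneE.
rewrite big_cons IHr /gword malgM_def fgmulUU mulr1 fmuE.
by rewrite -[mmul _ _]/(fmmul _ _) fmmulE.
Qed.

Lemma gstar_id_submod : is_submod (@gstar_id F gT tau A S).
Proof.
split; first by split=> [|a _]; rewrite ?mcoeff0 ?linear0.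
move=> c u v [u0 Iu] [v0 Iv]; split; first by rewrite mcoeffD mcoeffZ u0 v0 mulr0 addr0.
by move=> a ha; rewrite linearP /= Iu // Iv // scaler0 addr0.
Qed.

End Substitution.

Section Multilinear.
Context (F : fieldType) (gT : finGroupType).

(** The monomials spanning the multilinear polynomials are the words in which
    each index below n occurs once; the permutation reads off the indices. *)
Lemma gword_multilinear n (l : seq (gvar gT)) :
  perm_eq [seq v.1.1 | v <- l] (iota 0 n) -> gmultilinear n (gword F l).
Proof.
move=> pl; pose v0 : gvar gT := (0%N, 1%g, false).
have szl : size l = n by rewrite -(size_map (fun v => v.1.1)) (perm_size pl) size_iota.
have lt_l (i : 'I_n) : ((nth v0 l i).1.1 < n)%N.
  have : (nth v0 l i).1.1 \in iota 0 n.
    by rewrite -(perm_mem pl); apply/map_f/mem_nth; rewrite szl.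
  by rewrite mem_iota.
pose f i := Ordinal (lt_l i).
have f_inj : injective f.
  move=> i j /(congr1 val) /= /eqP eqij; apply/val_inj/eqP => /=.
  have ul : uniq [seq v.1.1 | v <- l] by rewrite (perm_uniq pl) iota_uniq.
  rewrite -(nth_uniq 0%N _ _ ul) ?size_map ?szl //.
  by rewrite !(nth_map v0) ?szl.
pose s := perm f_inj; pose g := [ffun i : 'I_n => (nth v0 l i).1.2].
pose e := [ffun i : 'I_n => (nth v0 l i).2].
have -> : gword F l = gmonomial F s g e.
  rewrite gmonomialE; congr (gword F _).
  apply: (@eq_from_nth _ v0); first by rewrite size_map size_enum_ord.
  move=> i; rewrite szl => ltin.
  rewrite (nth_map (Ordinal ltin)) ?size_enum_ord //.
  have -> : nth (Ordinal ltin) (enum 'I_n) i = Ordinal ltin.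
    by apply: val_inj; rewrite /= nth_enum_ord.
  by rewrite permE !ffunE /=; case: (nth v0 l i) => [[]].
exists (fun s' g' e' => ((s' == s) && (g' == g) && (e' == e))%:R).
rewrite (bigD1 s) //= [X in _ + X]big1 ?addr0; last first.
  by move=> s' /negPf s's; do 2!(rewrite big1 // => ? _); rewrite s's scale0r.
rewrite (bigD1 g) //= [X in _ + X]big1 ?addr0; last first.
  by move=> g' /negPf g'g; rewrite big1 // => ? _; rewrite g'g andbF scale0r.
rewrite (bigD1 e) //= [X in _ + X]big1 ?addr0; last first.
  by move=> e' /negPf e'e; rewrite e'e andbF scale0r.
by rewrite !eqxx scale1r.
Qed.

Lemma gmultilinear_coef1 n (f : gfree F gT) : (0 < n)%N -> gmultilinear n f ->
  f@_(@fmone (gvar gT)) = 0.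
Proof.
move=> n0 [c ->]; rewrite raddf_sum big1 // => s _.
rewrite raddf_sum big1 // => g _; rewrite raddf_sum big1 // => e _ /=.
rewrite mcoeffZ gmonomialE mcoeffU1 fmoneE.
case: eqP => [[/(congr1 size)]|_]; last by rewrite mulr0.
by rewrite size_map size_enum_ord => n1; rewrite n1 in n0.
Qed.

End Multilinear.

(** A subspace given by a proposition is the largest of the detachable
    subspaces that it contains. *)
Lemma vspace_of_submod (F : fieldType) (A : vectType F) (P : A -> Prop) :
  is_submod P -> exists U : {vspace A}, forall x, x \in U <-> P x.
Proof.
move=> [P0 Plin].
pose Q d := `[< exists2 U : {vspace A}, \dim U = d & forall x, x \in U -> P x >].
have exQ : exists d, Q d.
  by exists 0%N; apply/asboolP; exists 0%VS; rewrite ?dimv0 // => x /[!memv0]/eqP->.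
have leQ d : Q d -> (d <= \dim {:A})%N.
  by move=> /asboolP[U <- _]; apply: dimvS; apply: subvf.
case: (ex_maxnP exQ leQ) => d /asboolP[U dU UP] dmax.
exists U => x; split=> [/UP//|Px]; apply: contrapT => /negP xU.
have : (\dim (U + <[x]>) <= d)%N.
  apply: dmax; apply/asboolP; exists (U + <[x]>)%VS => // y.
  case/memv_addP => u uU [v /vlineP[c ->] ->].
  by rewrite addrC; apply: Plin => //; apply: UP.
rewrite -dU leqNgt => /negP[].
rewrite (ltn_leqif (dimv_leqif_sup (addvSl _ _))).
by apply: contra xU => /subvP; apply; apply: (subvP (addvSr _ _)); apply: memv_line.
Qed.

(** The length dim A does not depend on P: the basis of the subspace is padded
    with zeros. *)
Lemma spanning_family (F : fieldType) (A : vectType F) (P : A -> Prop) :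
  is_submod P -> exists v : 'I_(\dim {:A}) -> A,
    (forall j, P (v j)) /\ forall x, P x -> exists c, x = \sum_j c j *: v j.
Proof.
move=> subP; have [U UP] := vspace_of_submod subP.
have leU : (\dim U <= \dim {:A})%N by apply/dimvS/subvf.
exists (fun j => (vbasis U)`_j); split=> [j|x /UP xU].
  apply/UP; have [ltj|gej] := ltnP j (\dim U).
    by apply: vbasis_mem; apply: mem_nth; rewrite size_tuple.
  by rewrite nth_default ?mem0v // size_tuple.
pose G k := if insub k is Some i then coord (vbasis U) i x else 0.
exists (fun j => G (val j)); rewrite {1}(coord_vbasis xU).
transitivity (\sum_(i < \dim U) G i *: (vbasis U)`_i).
  by apply: eq_bigr => i _; rewrite /G valK.
rewrite (big_ord_widen _ (fun k => G k *: (vbasis U)`_k) leU) big_mkcond /=.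
apply: eq_bigr => j _; case: ifPn => // gej.
by rewrite /G insubN // scale0r.
Qed.

(** * Bounds on codimensions by evaluations *)

Section Codimension.
Context (F : closedFieldType) (gT : finGroupType) (tau : gT -> gT).
Context (A : vectType F) (S : gstar_algebra tau A).

Local Notation "x ** y" := (gmul S x y) (at level 40, left associativity).
Local Notation "x ^s" := (gstar S x) (at level 2, format "x ^s").
Local Notation regmx := (regmx S).

Definition ghomog (a : nat -> gT -> A) := forall k g, a k g \in gcomp S g.

Lemma regmx_gprod l : l != [::] -> regmx (gprod S l) = \prod_(x <- l) regmx x.
Proof.
case: l => // x l _; rewrite big_cons /=.
elim: l x => [|y l IHl] x /=; first by rewrite big_nil mulr1.
by rewrite IHl big_cons regmxM mulrA.
Qed.

Lemma regmx_gmonomial (a : nat -> gT -> A) n (s : 'S_n) g e : (0 < n)%N ->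
  regmx (gsubst S a (gmonomial F s g e)) =
  \prod_(i < n) regmx (gsubst_var S a ((s i : nat), g i, e i)).
Proof.
move=> n0; rewrite gmonomialE gsubst_word regmx_gprod; last first.
  by rewrite -size_eq0 2!size_map size_enum_ord -lt0n.
rewrite -index_enum_ord.
by rewrite !big_map.
Qed.

Definition gspanning (B : finType) (deg : B -> gT) (el : B -> A) :=
  (forall b, el b \in gcomp S (deg b)) /\
  forall g x, x \in gcomp S g -> exists c : B -> F,
    x = \sum_(b | deg b == g) c b *: el b.

Lemma gcomp_is_submod g : is_submod (fun x => x \in gcomp S g).
Proof.
split=> [|c u v ug vg]; first exact: gcomp0.
by apply: gcompD => //; apply: gcompZ.
Qed.

Section Basis.
Context (B : finType) (deg : B -> gT) (el : B -> A).
Context (spB : gspanning deg el).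

(** The tuple w gives to the variable of index k and degree h the value
    el (w k) if h is the degree of el (w k), and 0 otherwise, so that a
    monomial survives only if its degrees are those of w. *)
Definition basic_subst n (w : {ffun 'I_n -> B}) (k : nat) (h : gT) : A :=
  if insub k is Some i then (if deg (w i) == h then el (w i) else 0) else 0.

(** A monomial uses each index below n with exactly one degree, so it is
    multilinear in the vectors (a k h)_h, k < n. *)
Lemma gmonomial_expand n (a : nat -> gT -> A) (C : nat -> B -> F) (s : 'S_n) g e : (0 < n)%N ->
    (forall k h, a k h = \sum_(b | deg b == h) C k b *: el b) ->
  gsubst S a (gmonomial F s g e) =
  \sum_(w : {ffun 'I_n -> B}) (\prod_(k < n) C k (w k)) *:
     gsubst S (basic_subst w) (gmonomial F s g e).
Proof.
move=> n0 aE; apply: (@regmx_inj _ _ _ _ S); rewrite regmx_gmonomial // linear_sum.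
pose G i b : A := let x := if deg b == g i then el b else 0 in if e i then x^s else x.
have varE i : gsubst_var S a ((s i : nat), g i, e i) = \sum_b C (s i) b *: G i b.
  have -> : \sum_b C (s i) b *: G i b =
      if e i then (a (s i) (g i))^s else a (s i) (g i).
    rewrite /G aE; case: (e i).
      rewrite linear_sum [RHS]big_mkcond; apply: eq_bigr => b _ /=.
      by case: ifP => // _; rewrite ?linearZ // gstar0 scaler0.
    rewrite [RHS]big_mkcond; apply: eq_bigr => b _ /=.
    by case: ifP => // _; rewrite scaler0.
  by [].
under eq_bigr do rewrite varE linear_sum /=.
rewrite bigA_distr_bigA /=.
pose h (w : {ffun 'I_n -> B}) := [ffun i => w (s i)].
have h_bij : bijective h.
  exists (fun u : {ffun 'I_n -> B} => [ffun i => u (s^-1%g i)]) => u;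
    by apply/ffunP => i; rewrite !ffunE ?permKV ?permK.
rewrite (reindex h) /=; last exact: onW_bij.
apply: eq_bigr => w _; rewrite linearZ /= regmx_gmonomial //.
under eq_bigr do rewrite linearZ /=.
rewrite scaler_prod; congr (_ *: _).
  by rewrite [RHS](reindex_perm s) /=; apply: eq_bigr => i _; rewrite ffunE.
apply: eq_bigr => i _; congr regmx; rewrite /G ffunE /= /basic_subst valK.
by [].
Qed.

Lemma basic_zero_id n (f : gfree F gT) : (0 < n)%N -> gmultilinear n f ->
    (forall w : {ffun 'I_n -> B}, gsubst S (basic_subst w) f = 0) ->
  gstar_id S f.
Proof.
move=> n0 fn f0; split; first exact: gmultilinear_coef1 fn.
move=> a ha.
have [c cE] := boolp.choice (fun kh : nat * gT => spB.2 kh.2 _ (ha kh.1 kh.2)).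
pose C k b := c (k, deg b) b.
have aE k h : a k h = \sum_(b | deg b == h) C k b *: el b.
  by have /= -> := cE (k, h); apply: eq_bigr => b /eqP <-.
case: fn => cf def_f.
suff -> : gsubst S a f = \sum_(w : {ffun 'I_n -> B}) (\prod_(k < n) C k (w k)) *:
     gsubst S (basic_subst w) f.
  by rewrite big1 // => w _; rewrite f0 scaler0.
rewrite def_f.
transitivity (\sum_s \sum_g \sum_e \sum_(w : {ffun 'I_n -> B}) (\prod_(k < n) C k (w k)) *:
     (cf s g e *: gsubst S (basic_subst w) (gmonomial F s g e))).
  rewrite (linear_sum (gsubst S _)); apply: eq_bigr => s _.
  rewrite (linear_sum (gsubst S _)); apply: eq_bigr => g _.
  rewrite (linear_sum (gsubst S _)); apply: eq_bigr => e _ /=.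
  rewrite linearZ /= (gmonomial_expand _ _ _ n0 aE) scaler_sumr.
  by apply: eq_bigr => w _; rewrite !scalerA mulrC.
under eq_bigr do under eq_bigr do rewrite exchange_big /=.
under eq_bigr do rewrite exchange_big /=.
rewrite exchange_big /=; apply: eq_bigr => w _.
rewrite (linear_sum (gsubst S _)) scaler_sumr; apply: eq_bigr => s _.
rewrite (linear_sum (gsubst S _)) scaler_sumr; apply: eq_bigr => g _.
rewrite (linear_sum (gsubst S _)) scaler_sumr; apply: eq_bigr => e _.
by congr (_ *: _); rewrite linearZ.
Qed.

(** Evaluation at the tuples of T embeds the quotient into a sum of #|T| copies
    of A. *)
Lemma quot_indep_upper n (T : {set {ffun 'I_n -> B}}) d : (0 < n)%N ->
    (forall w, w \notin T -> forall (s : 'S_n) g e,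
       gsubst S (basic_subst w) (gmonomial F s g e) = 0) ->
    quot_indep (@gmultilinear F gT n) (gstar_id S) d ->
  (d <= #|T| * dim A)%N.
Proof.
move=> n0 T0 [u [Wu indu]]; rewrite leqNgt; apply/negP => ltd.
pose Q i : 'M[F]_(#|T|, dim A) :=
  \matrix_(t < #|T|) v2r (gsubst S (basic_subst (enum_val t)) (u i)).
have [c c0 cP] := left_kernel_nontrivial (\matrix_(i < d) mxvec (Q i)) ltd.
have Q0 : \sum_i c 0 i *: Q i = 0.
  apply: (can_inj mxvecK); rewrite linear0 -cP linear_sum.
  rewrite mulmx_sum_row; apply: eq_bigr => i _.
  by rewrite linearZ rowK.
case/negP: c0; apply/eqP/rowP => i; rewrite mxE.
apply: (indu (fun i => c 0 i)).
apply: (@basic_zero_id n) => //.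
  have [cu cuE] := boolp.choice Wu.
  exists (fun s g e => \sum_i c 0 i * cu i s g e).
  rewrite (eq_bigr (fun j => \sum_s \sum_g \sum_e (c 0 j * cu j s g e) *: gmonomial F s g e)).
    rewrite exchange_big; apply: eq_bigr => s _; rewrite exchange_big.
    apply: eq_bigr => g _; rewrite exchange_big; apply: eq_bigr => e _.
    by rewrite scaler_suml.
  move=> j _; rewrite cuE scaler_sumr; apply: eq_bigr => s _.
  rewrite scaler_sumr; apply: eq_bigr => g _; rewrite scaler_sumr.
  by apply: eq_bigr => e _; rewrite scalerA.
move=> w; have [wT|wT] := boolP (w \in T); last first.
  rewrite linear_sum big1 // => j _ /=; rewrite linearZ /=.
  suff -> : gsubst S (basic_subst w) (u j) = 0 by rewrite scaler0.
  have [cu ->] := Wu j.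
  rewrite linear_sum big1 // => s _; rewrite linear_sum big1 // => g _.
  by rewrite linear_sum big1 // => e _ /=; rewrite linearZ /= T0 // scaler0.
apply: v2r_inj; rewrite linear0.
move/(congr1 (row (enum_rank_in wT w))): Q0; rewrite linear_sum raddf0 => <-.
rewrite (linear_sum (gsubst S _)) (linear_sum v2r); apply: eq_bigr => j _ /=.
by rewrite !linearZ /= rowK enum_rankK_in.
Qed.

End Basis.

Lemma gspanning_exists : exists (el : gT * 'I_(\dim {:A}) -> A), gspanning (fun b => b.1) el.
Proof.
have [v vP] := boolp.choice (fun g => spanning_family (gcomp_is_submod g)).
exists (fun b => v b.1 b.2); split=> [[g j]|g x]; first exact: (vP g).1.
move=> /(vP g).2[c ->]; exists (fun b => c b.2).
rewrite (reindex_onto (fun j => (g, j)) snd) /=; last by move=> [h j] /= /eqP ->.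
by apply: eq_bigl => j; rewrite !eqxx.
Qed.

Lemma gcodim_dim n : (0 < n)%N ->
  quot_dim (@gmultilinear F gT n) (gstar_id S) (gcodim S n).
Proof.
move=> n0; have [el spB] := gspanning_exists.
have [d qd] : exists d, quot_dim (@gmultilinear F gT n) (gstar_id S) d.
  apply: (quot_dim_exists (gstar_id_submod S)) => d.
  apply: (quot_indep_upper (T := [set: _]%SET) spB n0) => w.
  by rewrite finset.in_setT.
by apply: (xgetPex 0%N); exists d.
Qed.

Lemma gcodim_ge n d : (0 < n)%N ->
  quot_indep (@gmultilinear F gT n) (gstar_id S) d -> (d <= gcodim S n)%N.
Proof. by move=> n0; exact: (quot_dim_max (gstar_id_submod S) (gcodim_dim n0)). Qed.

Lemma gcodim_le (B : finType) (deg : B -> gT) (el : B -> A) n (T : {set {ffun 'I_n -> B}}) :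
    gspanning deg el -> (0 < n)%N ->
    (forall w, w \notin T -> forall (s : 'S_n) g e,
       gsubst S (basic_subst deg el w) (gmonomial F s g e) = 0) ->
  (gcodim S n <= #|T| * dim A)%N.
Proof.
move=> spB n0 T0; apply: (quot_indep_upper spB n0 T0).
by have [e [We _ inde]] := gcodim_dim n0; exists e.
Qed.

(** Words are independent modulo the identities once each of them is separated
    from the others by an evaluation.  The factor z, by which the values are
    multiplied, kills unwanted words that do not vanish themselves. *)
Lemma gcodim_words n m (w : m.-tuple bool -> seq (gvar gT)) : (0 < n)%N ->
    (forall t, perm_eq [seq v.1.1 | v <- w t] (iota 0 n)) ->
    (forall t, exists a z, ghomog a /\
      forall t', (regmx (gprod S [seq gsubst_var S a v | v <- w t']) * z != 0) = (t' == t)) ->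
  (2 ^ m <= gcodim S n)%N.
Proof.
move=> n0 pw sep; rewrite -{1}card_bool -card_tuple; apply: gcodim_ge => //.
exists (fun i => gword F (w (enum_val i))); split=> [i|c [_ c0] i].
  exact: gword_multilinear.
have [a [z [ha az]]] := sep (enum_val i).
move/(_ a ha): c0; rewrite linear_sum /= => /(congr1 (fun x => regmx x * z)).
rewrite linear0 mul0r linear_sum mulr_suml (bigD1 i) //= big1 ?addr0; last first.
  move=> j ji; rewrite !linearZ /= -scalerAl gsubst_word.
  have := az (enum_val j); rewrite (inj_eq enum_val_inj) (negPf ji) => /negbT.
  by rewrite negbK => /eqP ->; rewrite scaler0.
rewrite !linearZ /= -scalerAl gsubst_word => /eqP.
by rewrite scaler_eq0 => /orP[/eqP //|]; rewrite (negPf (etrans (az _) (eqxx _))).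
Qed.

End Codimension.

(** * Three sources of exponential growth *)

Lemma prod_eq0 (R : nzRingType) (I : eqType) (r : seq I) (f : I -> R) i :
  i \in r -> f i = 0 -> \prod_(j <- r) f j = 0.
Proof.
elim: r => // j r IHr; rewrite inE big_cons => /predU1P[-> ->|/IHr r0 /r0 ->].
  by rewrite mul0r.
by rewrite mulr0.
Qed.

Lemma neq_tuple_nth n (t u : n.-tuple bool) : t != u ->
  exists2 i, i \in iota 0 n & nth false t i != nth false u i.
Proof.
move=> tu; apply/hasP; apply: contraR tu => /hasPn tu; apply/eqP/val_inj.
apply: (@eq_from_nth _ false); rewrite !size_tuple // => i ltin.
by apply/eqP; rewrite -[_ == _]negbK; apply: tu; rewrite mem_iota.
Qed.

Section ExponentialLowerBounds.
Context (F : closedFieldType) (gT : finGroupType) (tau : gT -> gT).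
Context (tauM : forall g h : gT, tau (g * h)%g = (tau h * tau g)%g).
Context (A : vectType F) (S : gstar_algebra tau A).

Local Notation "x ** y" := (gmul S x y) (at level 40, left associativity).
Local Notation "x ^s" := (gstar S x) (at level 2, format "x ^s").
Local Notation regmx := (regmx S).
Local Notation A_ g := (gcomp S g).

Lemma tau1 : tau 1%g = 1%g.
Proof. by apply: (mulgI (tau 1%g)); rewrite -tauM !mulg1. Qed.

Lemma gstar_comp1 x : x \in A_ 1%g -> x^s \in A_ 1%g.
Proof. by move=> /gstar_comp; rewrite tau1. Qed.

Lemma gcompM1 x y : x \in A_ 1%g -> y \in A_ 1%g -> x ** y \in A_ 1%g.
Proof. by move=> x1 y1; rewrite -(mulg1 1%g); apply: gcomp_mul. Qed.

Lemma gcomp_pow g x n : x \in A_ g -> gpow S x n \in A_ (g ^+ n.+1)%g.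
Proof. by move=> xg; elim: n => //= n IHn; rewrite expgS; apply: gcomp_mul. Qed.

Lemma gcomp_pow1 x n : x \in A_ 1%g -> gpow S x n \in A_ 1%g.
Proof. by move=> /(@gcomp_pow _ _ n); rewrite expg1n. Qed.

(** The exponent n - 1 accounts for the variable that
    [exponential_of_bimodule] sets apart. *)
Definition at_least_exponential := forall n, (0 < n)%N -> (2 ^ n.-1 <= gcodim S n)%N.

Definition index_subst (d : nat -> gT) (x : nat -> A) (k : nat) (h : gT) : A :=
  if d k == h then x k else 0.

Lemma index_subst_homog d x : (forall k, x k \in A_ (d k)) -> ghomog S (index_subst d x).
Proof.
by move=> xd k g; rewrite /index_subst; case: eqP => [<-|_]; rewrite ?gcomp0.
Qed.

Lemma regmx_map (I : Type) (r : seq I) (a : nat -> gT -> A) (v : I -> gvar gT) : 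
  (0 < size r)%N ->
  regmx (gprod S [seq gsubst_var S a u | u <- [seq v i | i <- r]]) =
  \prod_(i <- r) regmx (gsubst_var S a (v i)).
Proof.
move=> r0; rewrite regmx_gprod; last by rewrite -size_eq0 2!size_map -lt0n.
by rewrite !big_map.
Qed.

Lemma leq_half_exp n : (2 ^ n.-1 <= 2 ^ n)%N.
Proof. by rewrite leq_pexp2l // leq_pred. Qed.

(** The power of exponent #[g] of a has degree 1, so a and this power are two
    values of different degrees all of whose products are powers of a.  A word
    whose degrees disagree with the evaluation contains a zero. *)
Lemma exponential_of_degree g a : g != 1%g -> a \in A_ g -> ~ gnil S a ->
  at_least_exponential.
Proof.
move=> g1 ag /not_gnil nila n n0; apply: leq_trans (leq_half_exp n) _.
pose d (t : n.-tuple bool) k := if nth false t k then g else 1%g.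
pose w t := [seq (i, d t i, false) | i <- iota 0 n] : seq (gvar gT).
apply: (@gcodim_words _ _ _ _ S n n w n0) => [t|t].
  by rewrite -map_comp map_id_in.
pose x k := if nth false t k then a else gpow S a #[g]%g.-1.
exists (index_subst (d t) x), 1; split.
  apply: index_subst_homog => k; rewrite /x /d; case: nth => //.
  by have := gcomp_pow #[g]%g.-1 ag; rewrite prednK ?order_gt0 // expg_order.
move=> t'; rewrite mulr1 regmx_map ?size_iota //=.
have [->|/neq_tuple_nth[i ii tt']] := eqVneq t' t; last first.
  apply/negbTE; rewrite negbK; apply/eqP/(@prod_eq0 _ _ _ _ i) => //.
  rewrite /index_subst /d; move: tt'; case: nth; case: nth => // _.
    by rewrite eq_sym (negPf g1) linear0.
  by rewrite (negPf g1) linear0.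
suff [k ->] : exists k, \prod_(i <- iota 0 n) regmx (index_subst (d t) x i (d t i)) =
    regmx a ^+ k by rewrite nila.
elim: (iota _ _) => [|i r [k IHr]]; first by exists 0%N; rewrite big_nil.
rewrite big_cons IHr /index_subst eqxx /x; case: nth.
  by exists k.+1; rewrite exprS.
by exists (#[g]%g.-1.+1 + k)%N; rewrite regmx_pow exprD.
Qed.

(** The words x_S z x_T, where S and T partition the first n - 1 indices.
    Evaluate z at euf, with u homogeneous, and each x_i at e or f: since
    fe = 0, the value is nonzero exactly when all the e are on the left and all
    the f on the right. *)
Lemma exponential_of_bimodule e f u : e \in A_ 1%g -> f \in A_ 1%g ->
    e ** e = e -> f ** f = f -> f ** e = 0 -> e ** u ** f != 0 ->
  at_least_exponential.
Proof.
move=> e1 f1 ee ff fe euf n n0.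
have [h [{}u uh {}euf]] : exists h, exists2 u, u \in A_ h & e ** u ** f != 0.
  have [v vh def_u] := gcomp_sum S u; apply: contrapT => none.
  case/negP: euf; rewrite def_u gmul_sumr gmul_suml big1 // => h _.
  by apply/eqP/negbNE/negP => nz; apply: none; exists h, (v h).
pose m := n.-1; have def_n : n = m.+1 by rewrite prednK.
pose w (t : m.-tuple bool) : seq (gvar gT) :=
  [seq (i, 1%g, false) | i <- iota 0 m & nth false t i] ++ (m, h, false) ::
  [seq (i, 1%g, false) | i <- iota 0 m & ~~ nth false t i].
apply: (@gcodim_words _ _ _ _ S n m w n0) => [t|t].
  rewrite map_cat /= -!map_comp !map_id_in // def_n -cat1s perm_catCA cat1s.
  rewrite -[m.+1]addn1 iotaD /= add0n cats1 perm_sym perm_rcons perm_cons perm_sym.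
  by rewrite (perm_filterC (nth false t)).
pose E := regmx e; pose Q := regmx f; pose U := regmx (e ** u ** f).
pose x k := if k == m then e ** u ** f else if nth false t k then e else f.
pose d k := if k == m then h else 1%g.
have EU : E * U = U by rewrite /E /U -regmxM !gmulA ee.
have UQ : U * Q = U by rewrite /Q /U -regmxM -!gmulA ff.
have QE : Q * E = 0 by rewrite -regmxM fe linear0.
have QU : Q * U = 0 by rewrite -EU mulrA QE mul0r.
have UE : U * E = 0 by rewrite -UQ -mulrA QE mulr0.
exists (index_subst d x), 1; split.
  apply: index_subst_homog => k; rewrite /x /d; case: eqP => _; last by case: nth.
  rewrite -[h]mulg1 -[(h * 1)%g]mul1g mulgA.
  by do !apply: gcomp_mul.
move=> t'; rewrite mulr1 regmx_gprod; last by rewrite /w map_cat; case: map.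
rewrite map_cat big_cat /= big_cons !big_map /= {2}/index_subst /d !eqxx.
have -> : regmx (x m) = U by rewrite /x eqxx.
have X_ i : i \in iota 0 m -> regmx (index_subst d x i 1) = if nth false t i then E else Q.
  rewrite mem_iota add0n => /andP[_ ltim].
  by rewrite /index_subst /d /x (ltn_eqF ltim) eqxx; case: nth.
rewrite (eq_big_seq (fun i => if nth false t i then E else Q)); last first.
  by move=> i; rewrite mem_filter => /andP[_ /X_].
rewrite [X in _ * (_ * X)](eq_big_seq (fun i => if nth false t i then E else Q)); last first.
  by move=> i; rewrite mem_filter => /andP[_ /X_].
rewrite !big_filter.
have left r : \prod_(i <- r | nth false t' i) (if nth false t i then E else Q) * U =
    if all (fun i => nth false t' i ==> nth false t i) r then U else 0.
  elim: r => [|i r IHr]; first by rewrite big_nil mul1r.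
  rewrite big_cons /=; case: (nth false t' i) => //=; rewrite -mulrA IHr.
  by case: (nth false t i); case: all => //=; rewrite ?mulr0.
have right r : U * \prod_(i <- r | ~~ nth false t' i) (if nth false t i then E else Q) =
    if all (fun i => nth false t i ==> nth false t' i) r then U else 0.
  elim: r => [|i r IHr]; first by rewrite big_nil mulr1.
  rewrite big_cons /=; case: (nth false t' i) => /=; first by rewrite implybT.
  by rewrite mulrA implybF; case: (nth false t i); rewrite ?UE ?mul0r ?UQ.
have U0 : U != 0.
  by apply: contra euf => /eqP U0; apply/eqP/(@regmx_inj _ _ _ _ S); rewrite linear0.
rewrite right; case: allP => [sub1|nsub]; last first.
  rewrite mulr0 eqxx; apply/esym/eqP => tt; apply: nsub => i _.
  by rewrite tt implybb.
rewrite left; case: allP => [sub2|nsub]; last first.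
  rewrite eqxx; apply/esym/eqP => tt; apply: nsub => i _.
  by rewrite tt implybb.
rewrite U0; apply/esym/eqP/eqP; apply: contraT => /neq_tuple_nth[i ii].
by move: (sub1 i ii) (sub2 i ii); case: nth; case: nth.
Qed.

(** A power c of b satisfies cc' = c'c = 0, where c' is the star of c.  Give
    each variable the value c or c'; a word whose stars match becomes a power
    of c, the word with all stars reversed a power of c', and the others
    vanish.  Multiplication by c removes the power of c'. *)
Lemma exponential_of_star b : b \in A_ 1%g -> b ** b^s = b^s ** b ->
    gnil S (b ** b^s) -> ~ gnil S b ->
  at_least_exponential.
Proof.
move=> b1 bbs [k bk] nilb n n0; apply: leq_trans (leq_half_exp n) _.
pose c := gpow S b k.
have c'c : c^s ** c = 0.
  apply: (@regmx_inj _ _ _ _ S); rewrite linear0 regmxM gstar_pow !regmx_pow.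
  rewrite -exprMn_comm -?regmxM; last by rewrite /GRing.comm -!regmxM bbs.
  by rewrite -bbs exprS bk mulr0.
pose B := regmx c.
have BB : regmx c^s * B = 0 by rewrite /B -regmxM c'c linear0.
have nilB j : B ^+ j != 0.
  apply/eqP => Bj; apply: nilb; exists (k.+1 * j)%N.
  by rewrite exprM -regmx_pow.
pose w (t : n.-tuple bool) : seq (gvar gT) :=
  [seq (i, 1%g, nth false t i) | i <- iota 0 n].
apply: (@gcodim_words _ _ _ _ S n n w n0) => [t|t].
  by rewrite -map_comp map_id_in.
pose x k := if nth false t k then c^s else c.
exists (index_subst (fun _ => 1%g) x), B; split.
  apply: index_subst_homog => i; rewrite /x.
  by case: nth; rewrite ?gstar_comp1 ?gcomp_pow1.
move=> t'; rewrite regmx_map ?size_iota //=.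
rewrite (eq_bigr (fun i => if nth false t' i == nth false t i then B else regmx c^s)); last first.
  move=> i _; rewrite /index_subst eqxx /x.
  by case: (nth false t i); case: (nth false t' i); rewrite ?gstarK.
have prodB r : \prod_(i <- r) (if nth false t' i == nth false t i then B else regmx c^s) * B =
    if all (fun i => nth false t' i == nth false t i) r then B ^+ (size r).+1 else 0.
  elim: r => [|i r IHr]; first by rewrite big_nil mul1r.
  rewrite big_cons -mulrA IHr /=; case: eqP => _ /=; case: all; rewrite ?mulr0 //.
  by rewrite exprS mulrA BB mul0r.
rewrite prodB; case: allP => [eqt|nsub]; last first.
  by rewrite eqxx; apply/esym/eqP => tt; apply: nsub => i _; rewrite tt.
rewrite nilB; apply/esym/eqP/eqP; apply: contraT => /neq_tuple_nth[i /eqt/eqP ->].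
by rewrite eqxx.
Qed.

End ExponentialLowerBounds.

(** * Structure of algebras without exponential growth *)

Section NonExponential.
Context (F : closedFieldType) (charF : [pchar F] =i pred0) (gT : finGroupType).
Context (tau : gT -> gT) (tauM : forall g h : gT, tau (g * h)%g = (tau h * tau g)%g).
Context (A : vectType F) (S : gstar_algebra tau A).

Local Notation "x ** y" := (gmul S x y) (at level 40, left associativity).
Local Notation "x ^s" := (gstar S x) (at level 2, format "x ^s").
Local Notation A_ g := (gcomp S g).
Local Notation t := (gtr S).

Lemma nonnil_idempotent x : ~ gnil S x -> exists f, [/\ f ** f = f, f != 0 &
  forall P : A -> Prop, is_submod P -> (forall i, P (gpow S x i)) -> P f].
Proof.
move=> /idempotent_of_nonnil[n [c [/= ff f0]]]; exists (\sum_i c i *: gpow S x i).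
by split=> // P subP Px; apply: is_submod_sum.
Qed.

Lemma two_neq0 : 2%:R != 0 :> F.
Proof. by move/pcharf0P: charF => ->. Qed.

Lemma double_eq0 (c : F) : c + c = 0 -> c = 0.
Proof.
by move/eqP; rewrite -mulr2n -mulr_natr mulf_eq0 (negPf two_neq0) orbF => /eqP.
Qed.

Lemma gtr_skew k : k^s = - k -> t k = 0.
Proof. by move=> kN; apply: double_eq0; rewrite -{1}gtr_star kN linearN addNr. Qed.

Lemma gcomp_sum_mem (I : Type) (r : seq I) (P : pred I) (v : I -> A) g :
  (forall i, P i -> v i \in A_ g) -> \sum_(i <- r | P i) v i \in A_ g.
Proof.
move=> vg; elim/big_rec: _ => [|i u Pi ug]; first exact: gcomp0.
by apply: gcompD => //; apply: vg.
Qed.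

Context (nexp : ~ at_least_exponential S).

Lemma gnil_degree g a : g != 1%g -> a \in A_ g -> gnil S a.
Proof.
by move=> g1 ag; apply: contrapT => na; apply/nexp/(exponential_of_degree g1 ag).
Qed.

Lemma corner_disjoint e f u : e \in A_ 1%g -> f \in A_ 1%g ->
  e ** e = e -> f ** f = f -> f ** e = 0 -> e ** u ** f = 0.
Proof.
move=> e1 f1 ee ff fe; apply: contrapT => /eqP euf; apply: nexp.
exact: exponential_of_bimodule e1 f1 ee ff fe euf.
Qed.

Lemma gnil_norm b : b \in A_ 1%g -> b ** b^s = b^s ** b -> gnil S (b ** b^s) -> gnil S b.
Proof.
move=> b1 bb nbb; apply: contrapT => nb; apply: nexp.
exact: (exponential_of_star tauM b1 bb nbb nb).
Qed.

Definition orth_family m (e : 'I_m -> A) :=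
  (forall i, [/\ e i \in A_ 1%g, (e i)^s = e i & e i != 0]) /\
  (forall i j, e i ** e j = if i == j then e i else 0).

Lemma orth_family_size m (e : 'I_m -> A) : orth_family e -> (m <= dim A)%N.
Proof.
move=> [e_ ee]; rewrite leqNgt; apply/negP => ltm.
have [c c0 cP] := left_kernel_nontrivial (\matrix_i v2r (e i)) ltm.
case/negP: c0; apply/eqP/rowP => j; rewrite mxE.
have c0 : \sum_i c 0 i *: e i = 0.
  apply: v2r_inj; rewrite linear0 -cP linear_sum mulmx_sum_row.
  by apply: eq_bigr => i _; rewrite linearZ rowK.
move/(congr1 (fun x => x ** e j)): c0; rewrite gmul0r gmul_suml (bigD1 j) //=.
rewrite big1 => [|i ij]; last by rewrite -gscaleAl ee (negPf ij) scaler0.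
rewrite addr0 -gscaleAl ee eqxx => /eqP; rewrite scaler_eq0.
by case: (e_ j) => _ _ /negPf -> /[!orbF]/eqP.
Qed.

(** An idempotent f commuting with the family splits each e_k as
    e_k f + e_k (1 - f); the new family consists of f and the second parts. *)
Lemma orth_family_extend m (e : 'I_m -> A) f : orth_family e ->
    f \in A_ 1%g -> f^s = f -> f ** f = f -> f != 0 ->
    (forall k, f ** e k = e k ** f) -> (forall k, e k ** f != e k) ->
  exists e' : 'I_m.+1 -> A, orth_family e'.
Proof.
move=> [e_ ee] f1 fs ff f0 fe nef.
exists (fun i => if unlift ord0 i is Some k then e k - e k ** f else f); split.
  move=> i; case: unliftP => [k _|_] //; have [ek1 eks ek0] := e_ k; split.
  - by apply: gcompB => //; apply: gcompM1.
  - by rewrite gstarB gstarM eks fs fe.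
  - by rewrite subr_eq0 eq_sym.
move=> i j; case: unliftP => [k ->|->]; case: unliftP => [l ->|->].
- rewrite (inj_eq lift_inj) gmulBl !gmulBr !gmulA -(gmulA S (e k) f (e l)) fe !gmulA.
  rewrite -(gmulA S (e k ** e l) f f) ff subrr subr0 ee; case: eqP => [->//|_].
  by rewrite gmul0r subr0.
- by rewrite gmulBl -gmulA ff subrr eq_sym eq_liftF.
- by rewrite gmulBr gmulA fe -gmulA ff subrr eq_liftF.
- by rewrite eqxx.
Qed.

Lemma maximal_orth_family : exists m (e : 'I_m -> A), orth_family e /\
  forall f, f \in A_ 1%g -> f^s = f -> f ** f = f -> f != 0 ->
    (forall k, f ** e k = e k ** f) -> exists k, e k ** f = e k.
Proof.
have exm : exists m, `[< exists e : 'I_m -> A, orth_family e >].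
  by exists 0%N; apply/asboolP; exists (fun _ => 0); split=> [[]|[]].
have lem m : `[< exists e : 'I_m -> A, orth_family e >] -> (m <= dim A)%N.
  by move=> /asboolP[e /orth_family_size].
case: (ex_maxnP exm lem) => m /asboolP[e eP] mmax.
exists m, e; split=> // f f1 fs ff f0 fe; apply: contrapT => none.
have : (m.+1 <= m)%N; last by rewrite ltnn.
apply/mmax/asboolP; apply: (orth_family_extend eP f1 fs ff f0 fe) => k.
by apply/eqP => ekf; apply: none; exists k.
Qed.

(** The hypothesis emax is what [orth_family_extend] says about a family of
    maximal size. *)

Section Frame.
Context (m : nat) (e : 'I_m -> A) (eP : orth_family e).
Context (emax : forall f, f \in A_ 1%g -> f^s = f -> f ** f = f -> f != 0 ->
    (forall k, f ** e k = e k ** f) -> exists k, e k ** f = e k).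

Lemma frame_deg1 i : e i \in A_ 1%g. Proof. by case: (eP.1 i). Qed.
Lemma frame_sym i : (e i)^s = e i. Proof. by case: (eP.1 i). Qed.
Lemma frame_neq0 i : e i != 0. Proof. by case: (eP.1 i). Qed.
Lemma frame_mul i j : e i ** e j = if i == j then e i else 0. Proof. exact: eP.2. Qed.
Lemma frame_idem i : e i ** e i = e i. Proof. by rewrite frame_mul eqxx. Qed.
Lemma frame_orth i j : i != j -> e i ** e j = 0. Proof. by rewrite frame_mul => /negPf->. Qed.
Lemma gtr_frame_neq0 i : t (e i) != 0.
Proof. by apply: gtr_idem => //; rewrite ?frame_idem ?frame_neq0. Qed.
Lemma frame_corner0 i j u : i != j -> e i ** u ** e j = 0.
Proof.
by move=> ij; apply: corner_disjoint; rewrite ?frame_deg1 ?frame_idem ?frame_orth // eq_sym.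
Qed.

Lemma sym_submod : is_submod (fun y => y^s = y).
Proof. by split=> [|c u v us vs]; rewrite ?gstar0 // gstarD gstarZ us vs. Qed.
Lemma mull_submod a b : is_submod (fun y => a ** y = b *: y).
Proof.
split=> [|c u v us vs]; first by rewrite gmulr0 scaler0.
by rewrite gmulDr -gscaleAr us vs scalerDr !scalerA mulrC.
Qed.
Lemma mulr_submod a b : is_submod (fun y => y ** a = b *: y).
Proof.
split=> [|c u v us vs]; first by rewrite gmul0r scaler0.
by rewrite gmulDl -gscaleAl us vs scalerDr !scalerA mulrC.
Qed.

Lemma gpow_mull a b x : a ** x = b *: x -> forall i, a ** gpow S x i = b *: gpow S x i.
Proof.
by move=> ax [|i] //=; rewrite gmulA ax -gscaleAl.
Qed.
Lemma gpow_mulr a b x : x ** a = b *: x -> forall i, gpow S x i ** a = b *: gpow S x i.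
Proof.
by move=> ax; elim=> [|i IHi] //=; rewrite -gmulA IHi -gscaleAr.
Qed.
Lemma gpow_sym x : x^s = x -> forall i, (gpow S x i)^s = gpow S x i.
Proof. by move=> xs i; rewrite gstar_pow xs. Qed.

(** Otherwise an idempotent polynomial in x would be orthogonal to the whole
    family and extend it. *)
Lemma sym_outside_nil x : x \in A_ 1%g -> x^s = x ->
  (forall k, e k ** x = 0) -> (forall k, x ** e k = 0) -> gnil S x.
Proof.
move=> x1 xs ex xe; apply: contrapT => /nonnil_idempotent[f [ff f0 Pf]].
have ef k : e k ** f = 0 *: f.
  by apply: (Pf (fun y => e k ** y = 0 *: y));
    [apply: mull_submod | apply: gpow_mull; rewrite scale0r].
have fe k : f ** e k = 0 *: f.
  by apply: (Pf (fun y => y ** e k = 0 *: y));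
    [apply: mulr_submod | apply: gpow_mulr; rewrite scale0r].
have f1 : f \in A_ 1%g.
  by apply: (Pf (fun y => y \in A_ 1%g)); [apply: gcomp_is_submod | move=> i; apply: gcomp_pow1].
have fs : f^s = f by apply: (Pf (fun y => y^s = y)); [apply: sym_submod | apply: gpow_sym].
have [k|k] := emax f1 fs ff f0; first by rewrite ef fe.
by rewrite ef scale0r => /esym/eqP; rewrite (negPf (frame_neq0 k)).
Qed.

(** With E = e_1 + ... + e_m, the trace vanishes on (1 - E) A (1 - E): in
    degree 1 it only sees the symmetric part, which is nilpotent, and in the
    other degrees all elements are nilpotent. *)
Lemma gtr_frame w : t w = \sum_i t (e i ** w).
Proof.
have hom g v : v \in A_ g -> t v = \sum_i t (e i ** v).
  have [-> v1|g1 vg] := eqVneq g 1%g; last first.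
    rewrite (gtr_nil (gnil_degree g1 vg)) big1 // => i _.
    apply: gtr_nil; apply: (gnil_degree g1).
    by rewrite -[g]mul1g; apply: gcomp_mul; rewrite ?frame_deg1.
  pose E := \sum_i e i; have E1 : E \in A_ 1%g by apply: gcomp_sum_mem => i _; apply: frame_deg1.
  have eE k : e k ** E = e k.
    rewrite gmul_sumr (bigD1 k) //= frame_idem big1 ?addr0 // => i ik.
    by rewrite frame_orth // eq_sym.
  have Ee k : E ** e k = e k.
    rewrite gmul_suml (bigD1 k) //= frame_idem big1 ?addr0 // => i ik.
    by rewrite frame_orth.
  have EE : E ** E = E.
    by rewrite {2}/E gmul_sumr; apply: eq_bigr => k _; apply: Ee.
  (* This is (1 - E) v (1 - E). *)
  pose u := v - E ** v - (v - E ** v) ** E.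
  have u1 : u \in A_ 1%g by do !(apply: gcompB || apply: gcompM1 => //) => //.
  have eu k : e k ** u = 0.
    have z : e k ** (v - E ** v) = 0 by rewrite gmulBr gmulA eE subrr.
    by rewrite /u gmulBr gmulA z gmul0r subr0.
  have ue k : u ** e k = 0 by rewrite /u gmulBl -gmulA Ee subrr.
  have tu : t u = t v - t (E ** v).
    rewrite /u !linearB /= (gtrC _ _ E) gmulBr gmulA EE subrr linear0 subr0.
    by [].
  have : t (u + u^s) = 0.
    apply/gtr_nil/sym_outside_nil.
    - by apply: gcompD => //; apply: gstar_comp1.
    - by rewrite gstarD gstarK addrC.
    - by move=> k; rewrite gmulDr eu -{1}[e k]frame_sym -gstarM ue gstar0 addr0.
    - by move=> k; rewrite gmulDl ue -{1}[e k]frame_sym -gstarM eu gstar0 addr0.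
  rewrite linearD /= gtr_star => /double_eq0; rewrite tu => /eqP.
  by rewrite subr_eq0 => /eqP ->; rewrite gmul_suml linear_sum.
have [v vg ->] := gcomp_sum S w.
rewrite linear_sum (eq_bigr _ (fun g _ => hom g _ (vg g))) exchange_big /=.
by apply: eq_bigr => i _; rewrite gmul_sumr linear_sum.
Qed.

Definition in_corner i x := e i ** x = x /\ x ** e i = x.

Lemma frame_in_corner i : in_corner i (e i). Proof. by split; rewrite frame_idem. Qed.
Lemma in_cornerD i x y : in_corner i x -> in_corner i y -> in_corner i (x + y).
Proof. by move=> [x1 x2] [y1 y2]; split; rewrite ?gmulDr ?gmulDl ?x1 ?x2 ?y1 ?y2. Qed.
Lemma in_cornerZ i c x : in_corner i x -> in_corner i (c *: x).
Proof. by move=> [x1 x2]; split; rewrite -?gscaleAl -?gscaleAr ?x1 ?x2. Qed.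
Lemma in_cornerB i x y : in_corner i x -> in_corner i y -> in_corner i (x - y).
Proof. by move=> xi /(in_cornerZ (-1)); rewrite scaleN1r; apply: in_cornerD. Qed.
Lemma in_cornerM i x y : in_corner i x -> in_corner i y -> in_corner i (x ** y).
Proof. by move=> [x1 x2] [y1 y2]; split; rewrite ?gmulA ?x1 // -gmulA y2. Qed.
Lemma in_corner_star i x : in_corner i x -> in_corner i x^s.
Proof. by move=> [x1 x2]; split; rewrite -{1}[e i]frame_sym -gstarM ?x1 ?x2. Qed.
Lemma in_corner_pow i x k : in_corner i x -> in_corner i (gpow S x k).
Proof. by move=> xi; elim: k => //= k; apply: in_cornerM. Qed.

(** Apply to e_i the factors x - z of the characteristic polynomial one after
    the other; the last nonzero vector obtained is an eigenvector, and it stays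
    in e_i A. *)
Lemma corner_eigenvector i x : in_corner i x ->
  exists c v, [/\ v != 0, e i ** v = v & x ** v = c *: v].
Proof.
move=> xi; pose step (c : F) v := x ** v - c *: v.
have [rs def_P] := closed_field_poly_normal (char_poly (regmx S x)).
have lc1 : lead_coef (char_poly (regmx S x)) = 1.
  by apply/eqP; apply: char_poly_monic.
have stepE r : regmx S (foldr step (e i) r) =
    horner_mx (regmx S x) (\prod_(z <- r) ('X - z%:P)) * regmx S (e i).
  elim: r => [|z r IHr] /=; first by rewrite big_nil rmorph1 mul1r.
  rewrite /step linearB /= regmxM linearZ /= IHr big_cons rmorphM -mulrA /=.
  rewrite rmorphB /= horner_mx_X horner_mx_C mulrBl.
  by rewrite -[in RHS]scalemx1 -[_ *: 1%:M]/(z *: 1) -scalerAl mul1r.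
have : foldr step (e i) rs = 0.
  apply: (@regmx_inj _ _ _ _ S); rewrite linear0 stepE.
  move: (Cayley_Hamilton (regmx S x)); rewrite def_P lc1 scale1r => ->.
  by rewrite mul0r.
have eF r : e i ** foldr step (e i) r = foldr step (e i) r.
  elim: r => /= [|z r IHr]; first exact: frame_idem.
  by rewrite /step gmulBr gmulA xi.1 -gscaleAr IHr.
elim: rs {def_P} => [/= /eqP|z r IHr /= st0]; first by rewrite (negPf (frame_neq0 i)).
have [/IHr//|nz] := eqVneq (foldr step (e i) r) 0.
by exists z, (foldr step (e i) r); split=> //; apply/eqP; rewrite -subr_eq0 -/(step _ _) st0.
Qed.

(** Take for c an eigenvalue.  If x - c e_i were not nilpotent, the idempotent
    f that it generates would be nonzero, and different from e_i because it
    kills the eigenvector; then f and e_i - f would split e_i. *)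
Lemma sym_corner i x : x \in A_ 1%g -> x^s = x -> in_corner i x ->
  exists c, gnil S (x - c *: e i).
Proof.
move=> x1 xs xi; have [c [v [v0 ev xv]]] := corner_eigenvector xi.
exists c; set y := x - _; apply: contrapT => /nonnil_idempotent[f [ff f0 Pf]].
have yi : in_corner i y by apply/in_cornerB/in_cornerZ/frame_in_corner.
have y1 : y \in A_ 1%g by apply/gcompB/gcompZ/frame_deg1.
have ys : y^s = y by rewrite gstarB gstarZ frame_sym xs.
have yv : y ** v = 0 *: y.
  by rewrite gmulBl xv -gscaleAl ev subrr scale0r.
have ef k : e k ** f = (k == i)%:R *: f.
  apply: (Pf (fun y => e k ** y = (k == i)%:R *: y)); [exact: mull_submod | apply: gpow_mull].
  by rewrite -{1}yi.1 gmulA frame_mul; case: eqP => [->|_];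
    rewrite ?yi.1 ?scale1r // gmul0r scale0r.
have fe k : f ** e k = (k == i)%:R *: f.
  apply: (Pf (fun y => y ** e k = (k == i)%:R *: y)); [exact: mulr_submod | apply: gpow_mulr].
  rewrite -{1}yi.2 -gmulA frame_mul eq_sym; case: eqP => _; first by rewrite yi.2 scale1r.
  by rewrite gmulr0 scale0r.
have fv : f ** v = 0 *: f.
  by apply: (Pf (fun y => y ** v = 0 *: y)); [apply: mulr_submod | apply: gpow_mulr].
have f1 : f \in A_ 1%g.
  by apply: (Pf (fun y => y \in A_ 1%g)); [apply: gcomp_is_submod | move=> j; apply: gcomp_pow1].
have fs : f^s = f by apply: (Pf (fun y => y^s = y)); [apply: sym_submod | apply: gpow_sym].
have [k|k] := emax f1 fs ff f0; first by rewrite ef fe.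
rewrite ef; case: eqP => [->|_]; last first.
  by rewrite scale0r => /esym/eqP; rewrite (negPf (frame_neq0 k)).
rewrite scale1r => def_f; move: fv; rewrite def_f ev scale0r => /eqP.
by rewrite (negPf v0).
Qed.

Lemma gtr_sym_sqr i u : u \in A_ 1%g -> u^s = u -> in_corner i u -> t u = 0 -> t (u ** u) = 0.
Proof.
move=> u1 us ui tu; have [c nc] := sym_corner u1 us ui.
have := gtr_nil nc; rewrite linearB linearZ /= tu sub0r => /eqP.
rewrite oppr_eq0 mulf_eq0 (negPf (gtr_frame_neq0 i)) orbF => /eqP c0.
by move: nc; rewrite c0 scale0r subr0 => nu; apply/gtr_nil/gnilM_comm.
Qed.

(** The square of k is symmetric, hence c e_i plus a nilpotent.  If c = mu^2 is
    not zero, then b = mu e_i + k and its star mu e_i - k commute and have a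
    nilpotent product, whereas t(b) = mu t(e_i) <> 0. *)
Lemma gtr_skew_sqr i k : k \in A_ 1%g -> k^s = - k -> in_corner i k -> t (k ** k) = 0.
Proof.
move=> k1 ks ki; have [|c nc] := sym_corner (gcompM1 k1 k1) _ (in_cornerM ki ki).
  by rewrite gstarM ks gmulNl gmulNr opprK.
have tkk : t (k ** k) = c * t (e i).
  by have := gtr_nil nc; rewrite linearB linearZ /= => /eqP; rewrite subr_eq0 => /eqP.
have [mu mu2] : exists mu, mu ^+ 2 = c.
  have [mu muE] := solve_monicpoly (fun i => if i == 0%N then c else 0) (ltn0Sn 1).
  by exists mu; rewrite muE 2!big_ord_recl big_ord0 /= expr0 mulr1 mul0r !addr0.
have [mu0|mu0] := eqVneq mu 0.
  by rewrite tkk -mu2 mu0 expr0n mul0r.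
pose b := mu *: e i + k; have bs : b^s = mu *: e i - k by rewrite gstarD gstarZ frame_sym ks.
have ske : k ** e i = k := ki.2. have eke : e i ** k = k := ki.1.
have bb : b ** b^s = c *: e i - k ** k.
  rewrite bs gmulDl !gmulBr -!gscaleAl -!gscaleAr frame_idem eke ske scalerA -expr2 mu2.
  by rewrite addrA addrNK.
have bb' : b^s ** b = c *: e i - k ** k.
  rewrite bs gmulBl !gmulDr -!gscaleAl -!gscaleAr frame_idem eke ske scalerA -expr2 mu2.
  by rewrite opprD addrA addrK.
have b1 : b \in A_ 1%g by apply: gcompD => //; apply/gcompZ/frame_deg1.
have nb : gnil S b.
  apply: gnil_norm; rewrite ?bb ?bb' //.
  by rewrite -opprB; apply: gnilN.
have := gtr_nil nb; rewrite linearD linearZ /= (gtr_skew ks) addr0 => /eqP.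
by rewrite mulf_eq0 (negPf mu0) (negPf (gtr_frame_neq0 i)).
Qed.

(** Remove the trace of y by a multiple of e_i, and split x and y into symmetric
    and skew parts.  The squares of symmetric and of skew elements of trace zero
    have trace zero, so polarization handles the pure terms; the mixed products
    change sign under the star up to the order of the factors. *)
Lemma corner_form1 i x y : x \in A_ 1%g -> y \in A_ 1%g -> in_corner i x -> in_corner i y ->
  t x = 0 -> t (x ** y) = 0.
Proof.
move=> x1 y1 xi yi tx; wlog ty : y y1 yi / t y = 0 => [IH|].
  pose c := t y / t (e i).
  have -> : y = (y - c *: e i) + c *: e i by rewrite subrK.
  rewrite gmulDr -gscaleAr xi.2 gtrD gtrZ tx mulr0 addr0; apply: IH.
  - by apply/gcompB/gcompZ/frame_deg1.
  - by apply/in_cornerB/in_cornerZ/frame_in_corner.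
  - by rewrite gtrB gtrZ mulfVK ?subrr // gtr_frame_neq0.
have symD u : (u + u^s)^s = u + u^s by rewrite gstarD gstarK addrC.
have skewB u : (u - u^s)^s = - (u - u^s) by rewrite gstarB gstarK opprB.
have symT u : t u = 0 -> t (u + u^s) = 0 by rewrite gtrD gtr_star => ->; rewrite addr0.
have polar u v : t (u ** u) = 0 -> t (v ** v) = 0 -> t ((u + v) ** (u + v)) = 0 ->
    t (u ** v) = 0.
  move=> uu vv; rewrite gmulDl !gmulDr !gtrD uu vv addr0 add0r (gtrC S v u).
  exact: double_eq0.
have D1 u : u \in A_ 1%g -> u + u^s \in A_ 1%g by move=> u1; apply/gcompD/gstar_comp1.
have B1 u : u \in A_ 1%g -> u - u^s \in A_ 1%g by move=> u1; apply/gcompB/gstar_comp1.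
have Di u : in_corner i u -> in_corner i (u + u^s) by move=> ui; apply/in_cornerD/in_corner_star.
have Bi u : in_corner i u -> in_corner i (u - u^s) by move=> ui; apply/in_cornerB/in_corner_star.
have sym_skew u v : u^s = u -> v^s = - v -> t (u ** v) = 0.
  move=> us vs; apply: double_eq0.
  by rewrite -{1}gtr_star gstarM us vs gmulNl linearN /= gtrC addNr.
have ss : t ((x + x^s) ** (y + y^s)) = 0.
  apply: polar; apply: (gtr_sym_sqr (i := i)); rewrite ?D1 ?symD ?symT //; try exact: Di.
  - by apply: gcompD; apply: D1.
  - by rewrite gstarD !symD.
  - exact: (in_cornerD (Di _ xi) (Di _ yi)).
  - by rewrite gtrD !symT ?addr0.
have kk : t ((x - x^s) ** (y - y^s)) = 0.
  apply: polar; apply: (gtr_skew_sqr (i := i)); rewrite ?B1 ?skewB //; try exact: Bi.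
  - by apply: gcompD; apply: B1.
  - by rewrite gstarD !skewB [RHS]opprD.
  - exact: (in_cornerD (Bi _ xi) (Bi _ yi)).
have sk : t ((x + x^s) ** (y - y^s)) = 0 by apply: sym_skew.
have ks : t ((x - x^s) ** (y + y^s)) = 0 by rewrite gtrC; apply: sym_skew.
have twice u : u + u = (u + u^s) + (u - u^s) by rewrite addrCA addrK addrC.
(* It suffices to show 4 t(xy) = t((x + x)(y + y)) = 0. *)
apply: double_eq0; apply: double_eq0; rewrite -!gtrD -gmulDl.
have -> : (x + x) ** y + (x + x) ** y = (x + x) ** (y + y) by rewrite gmulDr.
rewrite (twice x) (twice y); move: ss kk sk ks.
move: (x + x^s) (x - x^s) (y + y^s) (y - y^s) => a b c d ss kk sk ks.
by rewrite gmulDl !gmulDr !gtrD ss kk sk ks !addr0.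
Qed.

(** Only deg y = g^-1 matters.  Then xy = c e_i + z in degree 1 with t(z) = 0,
    and the previous lemma gives t(x^k y^k) = c^k t(e_i) by induction on k; as x
    is nilpotent, c = 0. *)
Lemma corner_form_degree i g h x y : g != 1%g -> x \in A_ g -> y \in A_ h ->
  in_corner i x -> in_corner i y -> t (x ** y) = 0.
Proof.
move=> g1 xg yh xi yi; have [gh1|gh] := eqVneq (g * h)%g 1%g; last first.
  by apply: gtr_nil; apply: (gnil_degree gh); apply: gcomp_mul.
pose c := t (x ** y) / t (e i); pose z := x ** y - c *: e i.
have xy1 : x ** y \in A_ 1%g by rewrite -gh1; apply: gcomp_mul.
have zi : in_corner i z by apply: in_cornerB; [apply: in_cornerM|apply/in_cornerZ/frame_in_corner].
have z1 : z \in A_ 1%g by apply/gcompB/gcompZ/frame_deg1.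
have tz : t z = 0 by rewrite gtrB gtrZ mulfVK ?subrr // gtr_frame_neq0.
have powE k : t (gpow S x k ** gpow S y k) = c ^+ k.+1 * t (e i).
  elim: k => [|k IHk] /=; first by rewrite expr1 mulfVK // gtr_frame_neq0.
  have zE : z ** gpow S y k = x ** y ** gpow S y k - c *: gpow S y k.
    by rewrite /z gmulBl -gscaleAl (in_corner_pow k yi).1.
  have -> : x ** gpow S x k ** (y ** gpow S y k) =
      c *: (gpow S x k ** gpow S y k) + gpow S x k ** (z ** gpow S y k).
    have -> : x ** gpow S x k = gpow S x k ** x.
      by apply: (@regmx_inj _ _ _ _ S); rewrite !regmxM !regmx_pow -exprS -exprSr.
    by rewrite zE gmulBr -gscaleAr addrC subrK !gmulA.
  rewrite gtrD gtrZ IHk mulrA -exprS gtrC -gmulA (corner_form1 (i := i)) ?addr0 //.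
    rewrite -(_ : (h ^+ k.+1 * g ^+ k.+1)%g = 1%g).
      by apply: gcomp_mul; apply: gcomp_pow.
    have -> : h = (g^-1)%g by apply/eqP; rewrite eq_sym eq_invg_mul; apply/eqP.
    by rewrite expgVn mulVg.
  by apply: in_cornerM; apply: in_corner_pow.
have [k xk] := gnil_degree g1 xg.
have xk0 : gpow S x k = 0.
  by apply: (@regmx_inj _ _ _ _ S); rewrite linear0 regmx_pow exprS xk mulr0.
have := powE k; rewrite xk0 gmul0r linear0 => /esym/eqP.
rewrite mulf_eq0 (negPf (gtr_frame_neq0 i)) orbF expf_eq0 /= => /eqP/eqP.
by rewrite mulf_eq0 invr_eq0 (negPf (gtr_frame_neq0 i)) orbF => /eqP.
Qed.

Lemma corner_form i g x y : x \in A_ g -> in_corner i x -> in_corner i y ->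
  t (x ** y) = t x / t (e i) * t y.
Proof.
move=> xg xi yi; have [v vh def_y] := gcomp_sum S y.
have -> : y = \sum_h e i ** v h ** e i.
  by rewrite -gmul_suml -gmul_sumr -def_y yi.1 yi.2.
rewrite gmul_sumr !linear_sum mulr_sumr; apply: eq_bigr => h _ /=.
set u := e i ** v h ** e i; have uh : u \in A_ h.
  by rewrite -[h]mulg1 -[(h * 1)%g]mul1g mulgA; do !apply: gcomp_mul; rewrite ?frame_deg1.
have ui : in_corner i u by split; rewrite /u ?gmulA ?frame_idem // -gmulA frame_idem.
have [g1|g1] := eqVneq g 1%g; last first.
  rewrite (gtr_nil (gnil_degree g1 xg)) !mul0r.
  exact: (corner_form_degree g1 xg uh xi ui).
have [h1|h1] := eqVneq h 1%g; last first.
  rewrite (gtr_nil (gnil_degree h1 uh)) mulr0 gtrC.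
  exact: (corner_form_degree h1 uh xg ui xi).
pose c := t x / t (e i); have -> : x = (x - c *: e i) + c *: e i by rewrite subrK.
rewrite gmulDl gtrD -gscaleAl ui.1 gtrZ (corner_form1 (i := i)) ?add0r //.
- by rewrite subrK.
- by apply/gcompB/gcompZ/frame_deg1; rewrite -g1.
- by rewrite -h1.
- by apply/in_cornerB/in_cornerZ/frame_in_corner.
- by rewrite gtrB gtrZ mulfVK ?subrr // gtr_frame_neq0.
Qed.

Definition gtr_radical x := forall y, t (x ** y) = 0.

Lemma gtr_radical_submod : is_submod gtr_radical.
Proof.
split=> [y|c u v uK vK y]; first by rewrite gmul0r linear0.
by rewrite gmulDl -gscaleAl gtrD gtrZ uK vK mulr0 addr0.
Qed.
Lemma gtr_radicalMr x y : gtr_radical x -> gtr_radical (x ** y).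
Proof. by move=> xK z; rewrite -gmulA xK. Qed.
Lemma gtr_radicalMl x y : gtr_radical x -> gtr_radical (y ** x).
Proof. by move=> xK z; rewrite -gmulA gtrC -gmulA xK. Qed.
Lemma gtr_radical_star x : gtr_radical x -> gtr_radical x^s.
Proof. by move=> xK y; rewrite -gtr_star gstarM gstarK gtrC xK. Qed.
(** An ideal that is not nil contains a nonzero idempotent f, and
    t(ff) = t(f) <> 0. *)
Lemma gtr_radical_nil x : gtr_radical x -> gnil S x.
Proof.
move=> xK; apply: contrapT => /nonnil_idempotent[f [ff f0 Pf]].
have fK : gtr_radical f.
  by apply: Pf; [apply: gtr_radical_submod | elim=> //= k _; apply: gtr_radicalMr].
by have := fK f; rewrite ff => /eqP; rewrite (negPf (gtr_idem charF ff f0)).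
Qed.

(** Insert the family twice by [gtr_frame]; the mixed terms lie in e_j A e_i
    and vanish. *)
Lemma gtr_corners x y :
  t (x ** y) = \sum_i t ((e i ** x ** e i) ** (e i ** y ** e i)).
Proof.
rewrite gtr_frame; apply: eq_bigr => i _.
rewrite gmulA gtrC gtr_frame (bigD1 i) //= big1 ?addr0 => [|j ji]; last first.
  by rewrite !gmulA frame_corner0 // gmul0r linear0.
rewrite -!gmulA (gmulA S (e i) (e i)) frame_idem !gmulA.
by rewrite [RHS]gtrC !gmulA frame_idem -(gmulA S (e i ** x) (e i) y) [RHS]gtrC !gmulA.
Qed.

Lemma frame_mod_radical g x : x \in A_ g ->
  gtr_radical (x - \sum_i (t (e i ** x) / t (e i)) *: e i).
Proof.
move=> xg y; rewrite gmulBl gtrB gtr_corners gmul_suml linear_sum /= -sumrB big1 // => i _.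
have tE z : t (e i ** z ** e i) = t (e i ** z) by rewrite gtrC gmulA frame_idem.
rewrite (@corner_form i g) ?tE.
- by rewrite -gscaleAl gtrZ subrr.
- by rewrite -[g]mulg1 -[(g * 1)%g]mul1g mulgA; do !apply: gcomp_mul; rewrite ?frame_deg1.
- by split; rewrite ?gmulA ?frame_idem // -gmulA frame_idem.
- by split; rewrite ?gmulA ?frame_idem // -gmulA frame_idem.
Qed.

Lemma gcomp_frame_radical g x : x \in A_ g -> exists c z,
  [/\ x = \sum_(i | g == 1%g) c i *: e i + z, z \in A_ g & gtr_radical z].
Proof.
move=> xg; pose c i := t (e i ** x) / t (e i).
have sumE : \sum_(i | g == 1%g) c i *: e i = \sum_i c i *: e i.
  rewrite big_mkcond; apply: eq_bigr => i _; case: eqVneq => // g1.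
  rewrite /c gtr_nil ?mul0r ?scale0r //; apply: (gnil_degree g1).
  by rewrite -[g]mul1g; apply: gcomp_mul; rewrite ?frame_deg1.
exists c, (x - \sum_i c i *: e i); split; last exact: frame_mod_radical xg.
  by rewrite sumE addrC subrK.
apply: gcompB => //; have [->|g1] := eqVneq g 1%g.
  by apply: gcomp_sum_mem => i _; apply/gcompZ/frame_deg1.
rewrite big1 ?gcomp0 // => i _.
rewrite /c gtr_nil ?mul0r ?scale0r //; apply: (gnil_degree g1).
by rewrite -[g]mul1g; apply: gcomp_mul; rewrite ?frame_deg1.
Qed.

End Frame.
End NonExponential.

(** * Nil ideals are nilpotent *)

Section NilIdeal.
Context (F : closedFieldType) (gT : finGroupType) (tau : gT -> gT).
Context (A : vectType F) (S : gstar_algebra tau A).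

Local Notation "x ** y" := (gmul S x y) (at level 40, left associativity).

Context (K : A -> Prop) (subK : is_submod K).
Context (KMr : forall x y, K x -> K (x ** y)) (KMl : forall x y, K x -> K (y ** x)).
Context (Knil : forall x, K x -> gnil S x).

(** The left annihilator of the power K^j. *)
Fixpoint lann j (v : A) : Prop :=
  if j is j'.+1 then forall k, K k -> lann j' (v ** k) else v = 0.

Lemma lann_submod j : is_submod (lann j).
Proof.
elim: j => [|j [IH0 IH]] /=; first by split=> // c u v -> ->; rewrite scaler0 addr0.
split=> [k _|c u v uK vK k Kk]; first by rewrite gmul0r.
by rewrite gmulDl -gscaleAl; apply: IH; [apply: uK | apply: vK].
Qed.

Lemma lannM j v a : lann j v -> lann j (v ** a).
Proof.
elim: j v a => [|j IHj] v a /= => [->|vK k Kk]; first by rewrite gmul0r.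
by rewrite -gmulA; apply: vK; apply: KMl.
Qed.

Lemma lannS j v : lann j v -> lann j.+1 v.
Proof. by move=> vj k _; apply: lannM. Qed.

(** Among the v outside the j-th term choose one for which vK, modulo that term,
    has minimal dimension.  If vK is not contained in the term, take u = vk
    outside it; by minimality uK = vK modulo the term, so u = ul modulo the term
    for some l in K, which is absurd because l is nilpotent. *)
Lemma lann_strict j w : ~ lann j w -> exists v, ~ lann j v /\ lann j.+1 v.
Proof.
pose W v x := exists2 k, K k & lann j (x - v ** k).
have subW v : is_submod (W v).
  have [K0 Klin] := subK; have [a0 alin] := lann_submod j; split.
    by exists 0 => //; rewrite gmulr0 subr0.
  move=> c x y [k Kk xk] [l Kl yl]; exists (c *: k + l); first exact: Klin.
  have -> : c *: x + y - v ** (c *: k + l) = c *: (x - v ** k) + (y - v ** l).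
    by rewrite gmulDr -gscaleAr scalerBr opprD addrACA.
  exact: alin.
have [U UP] := boolp.choice (fun v => vspace_of_submod (subW v)).
move=> w0; pose P d := `[< exists2 v, ~ lann j v & \dim (U v) = d >].
have exP : exists d, P d by exists (\dim (U w)); apply/asboolP; exists w.
case: (ex_minnP exP) => d /asboolP[v vj dv] dmin.
exists v; split=> // k Kk; apply: contrapT => vkj.
have sub : (U (v ** k) <= U v)%VS.
  apply/subvP => x /UP[l Kl xl]; apply/UP; exists (k ** l); first exact: KMr.
  by rewrite gmulA.
have eqU : U (v ** k) = U v.
  apply/eqP; rewrite eqEdim sub dv; apply: dmin.
  by apply/asboolP; exists (v ** k).
have : v ** k \in U (v ** k).
  rewrite eqU; apply/UP; exists k => //; rewrite subrr; exact: (lann_submod j).1.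
case/UP => l Kl vkl; apply: vkj; move: vkl; set u := v ** k => ul.
have ulX n : lann j (u - u ** gpow S l n).
  elim: n => [|n IHn] //=.
  have -> : u - u ** (l ** gpow S l n) =
      1 *: (u - u ** gpow S l n) + (u - u ** l) ** gpow S l n.
    by rewrite scale1r gmulBl gmulA addrA subrK.
  by apply: (lann_submod j).2 => //; apply: lannM.
have [n ln] := Knil Kl; move: (ulX n).
have -> : gpow S l n = 0; last by rewrite gmulr0 subr0.
by apply: (@regmx_inj _ _ _ _ S); rewrite linear0 regmx_pow exprS ln mulr0.
Qed.

(** The terms grow strictly until they fill A. *)
Lemma lann_full v : lann (\dim {:A}) v.
Proof.
have [U UP] := boolp.choice (fun j => vspace_of_submod (lann_submod j)).
have grow j : (j <= \dim (U j))%N \/ (U j == fullv)%VS.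
  elim: j => [|j [IHj|/eqP Uj]]; first by left.
    have [Uf|Uf] := eqVneq (U j) fullv.
      right; apply/eqP/vspaceP => x; rewrite memvf.
      by apply/UP/lannS/UP; rewrite Uf memvf.
    left; apply: leq_ltn_trans IHj _.
    have [w wj] : exists w, ~ lann j w.
      apply: contrapT => all; case/negP: Uf; apply/eqP/vspaceP => x; rewrite memvf.
      by apply/UP; apply: contrapT => xj; apply: all; exists x.
    have [u [uj ujS]] := lann_strict wj.
    have sub : (U j <= U j.+1)%VS by apply/subvP => x /UP xj; apply/UP/lannS.
    rewrite (ltn_leqif (dimv_leqif_sup sub)); apply/negP => /subvP sub'.
    by apply: uj; apply/UP/sub'/UP.
  right; apply/eqP/vspaceP => x; rewrite memvf.
  by apply/UP/lannS/UP; rewrite Uj memvf.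
apply/UP; case: (grow (\dim {:A})) => [le|/eqP ->]; last exact: memvf.
have /eqP -> : U (\dim {:A}) == fullv by rewrite eqEdim subvf.
exact: memvf.
Qed.

(** Each factor in K lowers the level in the tower of annihilators, and the
    other factors do not raise it.  The inequality is strict because the first
    factor is the element to which the others are applied. *)
Lemma gprod_nil_ideal (l : seq A) :
  (\dim {:A} < count (fun x => `[< K x >]) l)%N -> gprod S l = 0.
Proof.
have foldl_rann j v r : lann j v -> (j <= count (fun x => `[< K x >]) r)%N ->
    foldl (gmul S) v r = 0.
  elim: r j v => [|x r IHr] j v /= vj; first by rewrite leqn0 => /eqP j0; rewrite j0 in vj.
  case: asboolP => Kx; last by rewrite add0n; apply: IHr; apply: lannM.
  case: j vj => [v0 _|j vj]; last by rewrite add1n ltnS; apply: IHr; apply: vj.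
  by apply: (IHr 0%N) => //=; rewrite v0 gmul0r.
case: l => // x l /= lt; apply: (foldl_rann (\dim {:A})); first exact: lann_full.
by rewrite -ltnS; apply: leq_trans lt _; rewrite -add1n leq_add2r; case: asboolP.
Qed.

End NilIdeal.

(** * Counting, and the polynomial bound *)

(** Such a tuple is determined by the constant b and a list of q corrections
    (position, value); tuples with fewer than q exceptions are obtained by
    padding this list with corrections that change nothing. *)
Lemma card_almost_constant (B : finType) n q (T : {set {ffun 'I_n -> B}}) : (0 < n)%N ->
    (forall w, w \in T -> exists b, #|[set k | w k != b]| <= q)%N ->
  (#|T| <= #|B| * (n * #|B|) ^ q)%N.
Proof.
case: n T => // n T _ Tq.
pose Phi (bh : B * {ffun 'I_q -> 'I_n.+1 * B}) : {ffun 'I_n.+1 -> B} :=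
  [ffun k => if [pick j | (bh.2 j).1 == k] is Some j then (bh.2 j).2 else bh.1].
have -> : (#|B| * (n.+1 * #|B|) ^ q)%N = #|[set: B * {ffun 'I_q -> 'I_n.+1 * B}]%SET|.
  by rewrite cardsT card_prod card_ffun card_prod !card_ord.
apply: leq_trans (leq_imset_card Phi _).
apply/subset_leq_card/fintype.subsetP => w /Tq[b leD].
pose D := [set k | w k != b]; pose pos j := nth ord0 (enum D) j.
apply/imsetP; exists (b, [ffun j : 'I_q => (pos j, w (pos j))]); first by rewrite inE.
apply/ffunP => k; rewrite ffunE /=; case: pickP => [j|none].
  by rewrite !ffunE /= => /eqP ->.
have [kD|] := boolP (k \in D); last by rewrite inE negbK => /eqP.
have ltk : (index k (enum D) < q)%N.
  by apply: leq_trans leD; rewrite cardE index_mem mem_enum.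
have := none (Ordinal ltk); rewrite ffunE /= /pos nth_index ?eqxx //.
by rewrite mem_enum.
Qed.

Section PolynomialBound.
Context (F : closedFieldType) (charF : [pchar F] =i pred0) (gT : finGroupType).
Context (tau : gT -> gT) (tauM : forall g h : gT, tau (g * h)%g = (tau h * tau g)%g).
Context (A : vectType F) (S : gstar_algebra tau A).

Local Notation "x ** y" := (gmul S x y) (at level 40, left associativity).
Local Notation "x ^s" := (gstar S x) (at level 2, format "x ^s").
Local Notation A_ g := (gcomp S g).
Local Notation regmx := (regmx S).

Lemma gprod_mem0 (l : seq A) : 0 \in l -> gprod S l = 0.
Proof.
case: l => // x l l0; apply: (@regmx_inj _ _ _ _ S); rewrite linear0 regmx_gprod //.
exact: (prod_eq0 l0 (linear0 _)).
Qed.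

(** Whatever the order of a and b in the product, the part from one to the
    other is zero. *)
Lemma gprod_disjoint (l : seq A) a b : a ** b = 0 -> b ** a = 0 ->
    (forall u, a ** u ** b = 0) -> (forall u, b ** u ** a = 0) ->
  a != b -> a \in l -> b \in l -> gprod S l = 0.
Proof.
move=> ab ba aub bua neq al bl; apply: (@regmx_inj _ _ _ _ S).
have mid c d r : c ** d = 0 -> (forall u, c ** u ** d = 0) ->
    regmx c * \prod_(x <- r) regmx x * regmx d = 0.
  case: r => [|x r] cd cud; first by rewrite big_nil mulr1 -regmxM cd linear0.
  by rewrite -regmx_gprod // -!regmxM cud linear0.
have l0 : l != [::] by case: (l) al.
rewrite linear0 regmx_gprod //; case/splitPr: l / al bl {l0} => p1 p2.
rewrite mem_cat inE eq_sym (negPf neq) /= => /orP[] /splitPr[p3 p4].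
  rewrite -catA !big_cat !big_cons /=.
  by rewrite (mulrA (regmx b * _)) mid // mul0r mulr0.
rewrite big_cat big_cons big_cat big_cons /=.
by rewrite (mulrA (regmx a)) (mulrA (regmx a * _)) mid // mul0r mulr0.
Qed.

Lemma exp_upper_bound : exists N, forall n, (0 < n)%N -> (gcodim S n <= N ^ n * dim A)%N.
Proof.
have [el spB] := gspanning_exists S; exists #|{: gT * 'I_(\dim {:A})}| => n n0.
have -> : (#|{: gT * 'I_(\dim {:A})}| ^ n)%N =
    #|[set: {ffun 'I_n -> gT * 'I_(\dim {:A})}]%SET|.
  by rewrite cardsT card_ffun card_ord.
by apply: (gcodim_le spB n0) => w; rewrite finset.in_setT.
Qed.

(** The spanning family consists of the e_i and, in each degree, of elements of
    the radical. *)
Lemma poly_upper_bound : ~ at_least_exponential S ->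
  exists N q, forall n, (0 < n)%N -> (gcodim S n <= N * n ^ q)%N.
Proof.
move=> nexp; have [m [e [eP emax]]] := maximal_orth_family S.
pose K := gtr_radical S; pose D := \dim {:A}.
have [v vP] := boolp.choice (fun g =>
  spanning_family (is_submodI (gcomp_is_submod S g) (gtr_radical_submod S))).
pose B := ('I_m + gT * 'I_D)%type.
pose deg (b : B) := match b with inl _ => 1%g | inr gj => gj.1 end.
pose el (b : B) := match b with inl i => e i | inr gj => v gj.1 gj.2 end.
have spB : gspanning S deg el.
  split=> [[i|[g j]]|g x xg] /=; [exact: frame_deg1 eP i|exact: ((vP g).1 j).1|].
  have [c [z [-> zg zK]]] := gcomp_frame_radical charF tauM nexp eP emax xg.
  have [d ->] := (vP g).2 z (conj zg zK).
  exists (fun b : B => match b with inl i => c i | inr gj => d gj.2 end).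
  rewrite big_sumType /=; congr (_ + _); first by apply: eq_bigl => i; rewrite eq_sym.
  rewrite (reindex_onto (fun j => (g, j)) snd) /=; last by move=> [h j] /= /eqP ->.
  by apply: eq_bigl => j; rewrite !eqxx.
exists (#|{: B}| * #|{: B}| ^ D * dim A)%N, D => n n0.
pose T := [set w : {ffun 'I_n -> B} | [exists b, #|[set k | w k != b]| <= D]%N].
have -> : (#|{: B}| * #|{: B}| ^ D * dim A * n ^ D = #|{: B}| * (n * #|{: B}|) ^ D * dim A)%N.
  by rewrite expnMn; lia.
apply: leq_trans (gcodim_le (T := T) spB n0 _) _; last first.
  rewrite leq_mul2r card_almost_constant ?orbT // => w.
  by rewrite inE => /existsP.
move=> w; rewrite inE => /existsPn far s g ep.
rewrite gmonomialE gsubst_word -map_comp; set x := _ \o _.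
have xE i : g i = deg (w (s i)) ->
    x i = if ep i then (el (w (s i)))^s else el (w (s i)).
  by rewrite /x /= /basic_subst valK => ->; rewrite eqxx.
have [/forallP degs|] := boolP [forall i, g i == deg (w (s i))]; last first.
  rewrite negb_forall => /existsP[i gi]; apply: gprod_mem0.
  apply/mapP; exists i; rewrite ?mem_enum //=.
  by rewrite /x /= /basic_subst valK eq_sym (negPf gi) gstar0 if_same.
have {degs}xE i : x i = if ep i then (el (w (s i)))^s else el (w (s i)).
  by apply: xE; apply/eqP.
pose isK (b : B) := if b is inr _ then true else false.
have Kx i : isK (w (s i)) -> K (x i).
  rewrite xE /el; case: (w (s i)) => // -[h j] _ /=.
  by case: (ep i); rewrite -?/K; [apply: gtr_radical_star|]; apply: ((vP h).1 j).2.
have ex i a : w (s i) = inl a -> x i = e a.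
  by rewrite xE /el => ->; case: (ep i); rewrite ?(frame_sym eP).
have mem_x i : x i \in [seq x i | i <- enum 'I_n] by apply: map_f; rewrite mem_enum.
have [/existsP[i1 /existsP[i2 /existsP[a1 /existsP[a2 /and3P[/eqP w1 /eqP w2 a12]]]]]|one] :=
    boolP [exists i1, exists i2, exists a1, exists a2,
            [&& w (s i1) == inl a1, w (s i2) == inl a2 & a1 != a2]].
  have a21 : a2 != a1 by rewrite eq_sym.
  apply: (gprod_disjoint (a := e a1) (b := e a2)).
  - exact: frame_orth eP _ _ a12.
  - exact: frame_orth eP _ _ a21.
  - by move=> u; apply: (frame_corner0 nexp eP).
  - by move=> u; apply: (frame_corner0 nexp eP).
  - apply: contra_neq (frame_neq0 eP a1) => e12.
    by rewrite -(frame_idem eP a1) {2}e12; apply: (frame_orth eP).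
  - by rewrite -(ex _ _ w1).
  - by rewrite -(ex _ _ w2).
(* At most one e_i occurs in w; take it for b.  If none occurs, any entry of w
   will do. *)
have [b bK] : exists b, forall k, w k != b -> isK (w k).
  have [/existsP[i0 /existsP[a0 /eqP w0]]|none] :=
    boolP [exists i, exists a, w (s i) == inl a].
    exists (inl a0) => k; case wk : (w k) => [a|//] aa0.
    case/negP: one; apply/existsP; exists (s^-1%g k); apply/existsP; exists i0.
    apply/existsP; exists a; apply/existsP; exists a0.
    by rewrite permKV wk w0 !eqxx.
  exists (w (Ordinal n0)) => k _; case wk : (w k) => [a|//].
  case/negP: none; apply/existsP; exists (s^-1%g k); apply/existsP; exists a.
  by rewrite permKV wk.
apply: (gprod_nil_ideal (K := K)).
- exact: gtr_radical_submod.
- exact: gtr_radicalMr.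
- exact: gtr_radicalMl.
- by move=> y; apply: (gtr_radical_nil charF).
rewrite count_map; move: (far b); rewrite -ltnNge => /leq_trans -> //.
have -> : [set k | w k != b] = s @: [set i | w (s i) != b].
  apply/setP => k; apply/idP/imsetP => [|[i]]; rewrite inE; last by move=> wi ->; rewrite inE.
  by move=> wk; exists (s^-1%g k); rewrite ?inE permKV.
apply: leq_trans (leq_imset_card _ _) _.
have -> : #|[set i | w (s i) != b]| = count (fun i => w (s i) != b) (enum 'I_n).
  by rewrite cardsE cardE -size_filter enumT.
apply: sub_count => i /= wi; apply/asboolP/Kx/bK; exact: wi.
Qed.

End PolynomialBound.

Theorem corollary3p7 (R : realType) (gT : finGroupType)
    (F : closedFieldType) (charF : [pchar F]%R =i pred0)
    (tau : gT -> gT)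
    (tauM : forall g h : gT, tau (g * h)%g = (tau h * tau g)%g)
    (tauK : involutive tau)
    (A : vectType F) (S : gstar_algebra tau A)
    (V : gstar_class F tau) (defV : V = gstar_var S) :
  poly_bounded R (gcodim S) \/ exp_growth R (gcodim S).
Proof.
have [expS|nexp] := pselect (at_least_exponential S); [right|left].
  have [N ubN] := exp_upper_bound S.
  exists 2^-1, 2, (dim A).+1%:R, N.+2%:R; split; rewrite ?ltr0n ?invr_gt0 ?ltr1n //.
  move=> n n0; split.
    rewrite ler_pdivrMl // -natrX -natrM ler_nat.
    by rewrite -[in leqLHS](prednK n0) expnS leq_mul2l expS.
  rewrite -natrX -natrM ler_nat; apply: leq_trans (ubN n n0) _.
  by rewrite mulnC leq_mul // leq_exp2r // ltnW.
have [N [q ubN]] := poly_upper_bound charF tauM nexp.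
exists N%:R, q%:R; split; rewrite ?ler0n // => n n0.
by rewrite powR_mulrn ?ler0n // -natrX -natrM ler_nat; apply: ubN.
Qed.
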